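(* Catabolizability $w\mapsto \mathrm{ctype}(w)$ is characterized as the statistic on standard words, i.e. it is the unique function from standard words (of all lengths) to partitions, that is invariant under non-zero corotations and non-zero rotations, catabolism transformations, and Knuth transformations, and that satisfies $$\mathrm{ctype}(\mathrm{rowword}(Z^*_\lambda))=\lambda$$ for every partition $\lambda$.
   Context: A standard word of length $n$ is a permutation $w=w_1\cdots w_n$ of $1,\dots,n$. Tableaux are in English notation; $\mathrm{rowword}(T)$ is the row reading word (rows read left to right, from the bottom row to the top row); $P(w)$ is the (Schensted row) insertion tableau of a word $w$, so $P(\mathrm{rowword}(T))=T$. Knuth transformations are the usual elementary Knuth relations on words. Cocharge labeling: the cocharge labeling $w^{\mathrm{cc}}$ of a standard word $w$ is the word of the same length obtained by labeling the numbers of $w$ in increasing order: $1$ is labeled $0$, and if $i$ is labeled $k$, then $i+1$ is labeled $k$ (resp. $k+1$) if $i+1$ appears to the right (resp. left) of $i$ in $w$; the label of $w_j$ is placed in position $j$. (Co)rotation: for a word $w$ and a number $a\neq 1$ such that $wa$ is a standard word, $aw$ is a corotation of $wa$ and $wa$ is a rotation of $aw$; these are non-zero if $a$ is labeled by a number greater than $0$ in the cocharge labeling of $wa$. Catabolism transformation: for a standard word $w$ with cocharge labeling $z=w^{\mathrm{cc}}$ and an index $i$ with $|z_i-z_{i+1}|>1$, the operation replacing $w$ by the word obtained by swapping the entries in positions $i$ and $i+1$. $Z^*_\lambda$ is the standard Young tableau of shape $\lambda\vdash n$ whose rows, from top to bottom and each read left to right, contain $1,2,\dots,n$ in order (equivalently,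 the cocharge labeling of its row reading word is the row reading word of the tableau of shape $\lambda$ with $0$'s in the first row, $1$'s in the second row, etc.). Catabolizability: for a tableau $T$ with distinct entries and with at least $m$ squares in its first row, $T_{(m)}$ is the subtableau formed by the first $m$ squares of the first row, and the $m$-catabolism is $\mathrm{cat}_m(T)=P(\mathrm{rowword}(T_n)\,\mathrm{rowword}(T_s))$, where $T_n$ is the first row of $T$ with $T_{(m)}$ removed and $T_s$ consists of the remaining rows of $T$. For a partition $\lambda$ of $|T|$ (the number of squares of $T$), $T$ is $\lambda$-catabolizable if its first row has at least $\lambda_1$ squares, $T_{(\lambda_1)}$ contains the $\lambda_1$ smallest entries of $T$, and $\mathrm{cat}_{\lambda_1}(T)$ is $\widehat\lambda$-catabolizable, where $\lambda=(\lambda_1,\widehat\lambda)$; the empty tableau is $\varnothing$-catabolizable. For a standard Young tableau $T$ there is a unique maximal (in dominance order) partition $\lambda$ such that $T$ is $\lambda$-catabolizable (a known fact); this $\lambda$ is the catabolizability $\mathrm{ctype}(T)$ of $T$. It is also obtained by repeatedly applying $\mathrm{cat}_m$ with the largest $m$ such that the first $m$ entries of the first row are the $m$ smallest entries of the current tableau, and recording the successive values of $m$. For a standard word $w$, $\mathrm{ctype}(w):=\mathrm{ctype}(P(w))$. *)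

(* Defs.v *)
From mathcomp Require Import all_boot.
From mathcomp Require Import zify.

Set Implicit Arguments.
Unset Strict Implicit.
Unset Printing Implicit Defensive.

(* Words are sequences of natural numbers; a tableau is the sequence of its
   rows, from top to bottom (English notation), without empty rows. *)

Definition is_standard (w : seq nat) : bool := perm_eq w (iota 1 (size w)).

Definition is_partition (la : seq nat) : bool := sorted geq la && (0 \notin la).

(* [fuel] bounds the number of parts, and [m] bounds their size. *)
Fixpoint partitions_rec (fuel m n : nat) : seq (seq nat) :=
  if n == 0 then [:: [::]] else
  if fuel is fuel'.+1 then
    flatten [seq map (cons k) (partitions_rec fuel' k (n - k))
            | k <- rev (iota 1 (minn m n))]
  else [::].

Definition partitions (n : nat) : seq (seq nat) := partitions_rec n n n.

Lemma mem_partitions n la :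
  (la \in partitions n) = is_partition la && (sumn la == n).
Proof.
have H fuel : forall m n la, n <= fuel ->
    (la \in partitions_rec fuel m n) =
      [&& is_partition la, all (geq m) la & sumn la == n].
  elim: fuel => [|fuel IHfuel] m {}n {}la.
    rewrite leqn0 => /eqP-> /=; rewrite inE.
    case: la => [|x s] //=; rewrite addn_eq0.
    by case: x => [|x]; rewrite /is_partition ?inE ?andbF.
  move=> le_n /=; case: eqP => [->|/eqP n_neq0].
    rewrite inE; case: la => [|x s] //=; rewrite addn_eq0.
    by case: x => [|x]; rewrite /is_partition ?inE ?andbF.
  have trans_geq : transitive geq by move=> x y z /= yx xz; exact: leq_trans xz yx.
  apply/flatten_mapP/idP => [[k]|].
    rewrite mem_rev mem_iota add1n ltnS leq_min => /and3P[k_gt0 le_km le_kn].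
    case/mapP => mu; rewrite IHfuel; last by lia.
    case/and3P=> /andP[s_mu mu0] le_mu /eqP sum_mu -> /=.
    rewrite /is_partition /= path_sortedE // s_mu le_mu inE negb_or mu0 /=.
    rewrite eq_sym -lt0n k_gt0 le_km sum_mu subnKC // eqxx /= andbT.
    by apply/allP => x /(allP le_mu) /= le_xk; exact: leq_trans le_xk le_km.
  case: la => [|k mu] /=; first by rewrite eq_sym (negPf n_neq0).
  rewrite /is_partition /= path_sortedE // inE negb_or.
  case/and3P=> /and3P[/andP[le_mu s_mu] k_gt0 mu0] /andP[le_km _] /eqP sum_mu.
  exists k; first by rewrite mem_rev mem_iota; lia.
  apply/mapP; exists mu => //; rewrite IHfuel; last by lia.
  by rewrite /is_partition s_mu mu0 le_mu; apply/eqP; lia.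
rewrite /partitions H //; case: eqP => [<-|]; rewrite ?andbF // !andbT.
case: (is_partition la) => //=; apply/allP => x x_la /=.
by elim: la x_la {H} => //= y s IHs; rewrite inE => /predU1P[->|/IHs le_x];
  [exact: leq_addr | exact: leq_trans le_x (leq_addl _ _)].
Qed.

(* Partial sums past the end of both partitions are constant, so checking
   finitely many k suffices. *)
Definition dominates (la mu : seq nat) : bool :=
  all (fun k => sumn (take k mu) <= sumn (take k la))
      (iota 0 (size la + size mu).+1).

Fixpoint row_insert (x : nat) (T : seq (seq nat)) : seq (seq nat) :=
  if T is r :: T' then
    let i := find (ltn x) r in
    if i < size r then set_nth 0 r i x :: row_insert (nth 0 r i) T'
    else rcons r x :: T'
  else [:: [:: x]].

Definition insertion_tableau (w : seq nat) : seq (seq nat) :=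
  foldl (fun T x => row_insert x T) [::] w.

Definition rowword (T : seq (seq nat)) : seq nat := flatten (rev T).

Definition first_row (T : seq (seq nat)) : seq nat := head [::] T.

Definition cat_tab (m : nat) (T : seq (seq nat)) : seq (seq nat) :=
  insertion_tableau (drop m (first_row T) ++ rowword (behead T)).

Fixpoint catabolizable (la : seq nat) (T : seq (seq nat)) : bool :=
  if la is m :: la' then
    [&& m <= size (first_row T),
        all (mem (take m (first_row T))) (take m (sort leq (rowword T))) &
        catabolizable la' (cat_tab m T)]
  else T == [::].

Definition catabolizable_partitions (T : seq (seq nat)) : seq (seq nat) :=
  [seq la <- partitions (size (rowword T)) | catabolizable la T].

(* For a standard Young tableau, there is exactly one dominance-maximal element
   among the partitions [la] such that [T] is [la]-catabolizable. *)
Definition ctype_tab (T : seq (seq nat)) : seq nat :=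
  let L := catabolizable_partitions T in
  head [::] [seq la <- L | all (fun mu => dominates mu la ==> (mu == la)) L].

Definition ctype (w : seq nat) : seq nat := ctype_tab (insertion_tableau w).

(* The cocharge label of the number k in w (the value at k = 0 is junk). *)
Fixpoint cocharge_label (w : seq nat) (k : nat) : nat :=
  match k with
  | 0 | 1 => 0
  | (i.+1 as j).+1 => cocharge_label w j + (index j.+1 w < index j w)
  end.

Definition cocharge_word (w : seq nat) : seq nat :=
  map (cocharge_label w) w.

(* v is a non-zero corotation of u: u = w a and v = a w. *)
Definition nonzero_corotation (u v : seq nat) : Prop :=
  exists w a, [/\ u = rcons w a, v = a :: w, a != 1 &
                  0 < last 0 (cocharge_word u)].

Definition nonzero_rotation (u v : seq nat) : Prop := nonzero_corotation v u.

Definition catabolism_transformation (u v : seq nat) : Prop :=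
  exists p a b q,
    [/\ u = p ++ [:: a; b] ++ q,
        v = p ++ [:: b; a] ++ q &
        let z := nth 0 (cocharge_word u) in let i := size p in
        ((z i).+1 < z i.+1) || ((z i.+1).+1 < z i)].

Inductive knuth_transformation : seq nat -> seq nat -> Prop :=
| Knuth_xzy p q x y z : x <= y < z ->
    knuth_transformation (p ++ [:: x; z; y] ++ q) (p ++ [:: z; x; y] ++ q)
| Knuth_zxy p q x y z : x <= y < z ->
    knuth_transformation (p ++ [:: z; x; y] ++ q) (p ++ [:: x; z; y] ++ q)
| Knuth_yxz p q x y z : x < y <= z ->
    knuth_transformation (p ++ [:: y; x; z] ++ q) (p ++ [:: y; z; x] ++ q)
| Knuth_yzx p q x y z : x < y <= z ->
    knuth_transformation (p ++ [:: y; z; x] ++ q) (p ++ [:: y; x; z] ++ q).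

(* The tableau Z*_la. *)
Definition superstandard (la : seq nat) : seq (seq nat) :=
  reshape la (iota 1 (sumn la)).

Definition invariant_under (R : seq nat -> seq nat -> Prop)
    (f : seq nat -> seq nat) : Prop :=
  forall u v, is_standard u -> is_standard v -> R u v -> f u = f v.

(* f restricts to a statistic from standard words to partitions with the listed
   properties; its values on other words are unconstrained. *)
Record catabolizability_properties (f : seq nat -> seq nat) : Prop := {
  valued_in_partitions : forall w, is_standard w -> is_partition (f w);
  corotation_invariant : invariant_under nonzero_corotation f;
  rotation_invariant : invariant_under nonzero_rotation f;
  catabolism_invariant : invariant_under catabolism_transformation f;
  knuth_invariant : invariant_under knuth_transformation f;
  superstandard_value :
    forall la, is_partition la -> f (rowword (superstandard la)) = la
}.

(* Main.v *)
Require Import Defs.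
From mathcomp Require Import all_boot.
From mathcomp Require Import zify.

(* Encode a standard word by its cocharge labeling and read that word cyclically
   from the right while growing a partition nu: the letter a adds a box to row a
   of nu when this gives a partition; otherwise it becomes a + 1 and moves to the
   front. The final partition is invariant under swapping adjacent letters that
   differ by more than 1 and under the relations aba = baa and bab = bba with
   b = a + 1, hence under Knuth and catabolism transformations; starting from the
   empty partition, a non-zero corotation is the first step of this process.
   On the row reading word of a tableau the first pass removes the 0's of the
   first row and rotates the rest of that row, which is a catabolism, so the
   final partition is the catabolizability. Conversely the steps are realized by
   the allowed transformations of the word x Z_nu, with Z_nu the label word of
   Z*_nu; they lead from any standard word to some Z*_la. *)

Set Implicit Arguments.
Unset Strict Implicit.
Unset Printing Implicit Defensive.

(** * The insertion process on label words *)

(** The congruence defining the local plactic monoid: distant letters commute, and Knuth relations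
    are imposed on each pair of neighbouring letters. *)
Inductive locplac : seq nat -> seq nat -> Prop :=
| locplac_refl u : locplac u u
| locplac_sym u v : locplac u v -> locplac v u
| locplac_trans v u w : locplac u v -> locplac v w -> locplac u w
| locplac_cat u u' v v' :
    locplac u u' -> locplac v v' -> locplac (u ++ v) (u' ++ v')
| locplac_far a b : a.+1 < b -> locplac [:: a; b] [:: b; a]
| locplac_aba a : locplac [:: a; a.+1; a] [:: a.+1; a; a]
| locplac_bab a : locplac [:: a.+1; a; a.+1] [:: a.+1; a.+1; a].

#[local] Hint Resolve locplac_refl : core.

Lemma locplac_cons a u v : locplac u v -> locplac (a :: u) (a :: v).
Proof. exact: (@locplac_cat [:: a] [:: a] u v). Qed.

Lemma locplac_catl u v w : locplac v w -> locplac (u ++ v) (u ++ w).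
Proof. exact: locplac_cat. Qed.

Lemma locplac_catr u v w : locplac u v -> locplac (u ++ w) (v ++ w).
Proof. by move=> uv; apply: locplac_cat. Qed.

Lemma locplac_perm u v : locplac u v -> perm_eq u v.
Proof.
elim=> {u v} //= [u v _|v u w _ uv _|u u' v v' _ uu' _|a b _|a|a].
- by rewrite perm_sym.
- exact: perm_trans.
- exact: perm_cat.
- by apply/permP => p /=; lia.
- by apply/permP => p /=; lia.
- by apply/permP => p /=; lia.
Qed.

Lemma locplac_shift u v : locplac u v -> locplac (map succn u) (map succn v).
Proof.
elim=> {u v} //= [u v _|v u w _ uv _ vw|u u' v v' _ uu' _ vv'|a b ab|a|a].
- exact: locplac_sym.
- exact: locplac_trans uv vw.
- by rewrite !map_cat; apply: locplac_cat.
- exact: locplac_far.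
- exact: locplac_aba.
- exact: locplac_bab.
Qed.

(** A Knuth relation exchanges [x] and [z]. Either these are far apart and commute, or [z = x + 1]
    and the inequalities determine [y]. *)
Lemma locplac_xzy x y z :
  x <= y < z -> locplac [:: x; z; y] [:: z; x; y].
Proof.
case: (ltnP x.+1 z) => [xz _|zx xyz].
  exact: (locplac_catr [:: y] (locplac_far xz)).
have [-> ->] : y = x /\ z = x.+1 by lia.
exact: locplac_aba.
Qed.

Lemma locplac_yxz x y z :
  x < y <= z -> locplac [:: y; x; z] [:: y; z; x].
Proof.
case: (ltnP x.+1 z) => [xz _|zx xyz].
  exact: (locplac_cons y (locplac_far xz)).
have [-> ->] : y = x.+1 /\ z = x.+1 by lia.
exact: locplac_bab.
Qed.

Definition addable (nu : seq nat) (a : nat) : bool :=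
  (a == 0) || (nth 0 nu a < nth 0 nu a.-1).

(** A state consists of the pending word and the partition grown so far. *)
Definition offer (a : nat) (s : seq nat * seq nat) : seq nat * seq nat :=
  if addable s.2 a then (s.1, incr_nth s.2 a) else (a.+1 :: s.1, s.2).

Definition step (s : seq nat * seq nat) : seq nat * seq nat :=
  if s.1 is a :: x then offer (last a x) (belast a x, s.2) else s.

Definition ev (s : seq nat * seq nat) (la : seq nat) : Prop :=
  exists N, iter N step s = ([::], la).

(** One full round of the process: each letter of [x] is offered once, from right to left, and the
    rejected letters, raised by one, form the next word. *)
Definition pass (x nu : seq nat) : seq nat * seq nat :=
  foldr offer ([::], nu) x.

Lemma step_rcons x a nu : step (rcons x a, nu) = offer a (x, nu).
Proof. by case: x => [|b x] //=; rewrite /step /= last_rcons belast_rcons. Qed.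

Lemma pass_acc x y nu :
  foldr offer (y, nu) x = ((pass x nu).1 ++ y, (pass x nu).2).
Proof.
elim: x => //= a x ->; rewrite /offer /=.
by case: (addable _ a).
Qed.

Lemma pass_cat u v nu :
  pass (u ++ v) nu =
  ((pass u (pass v nu).2).1 ++ (pass v nu).1, (pass u (pass v nu).2).2).
Proof. by rewrite /pass foldr_cat -pass_acc -surjective_pairing. Qed.

Lemma is_partition_cons m nu :
  is_partition (m :: nu) = [&& 0 < m, nth 0 nu 0 <= m & is_partition nu].
Proof.
rewrite /is_partition inE negb_or eq_sym -lt0n.
by case: nu => [|k nu] /=; rewrite ?andbT //; lia.
Qed.

Lemma is_partition_incr nu a :
  is_partition nu -> addable nu a -> is_partition (incr_nth nu a).
Proof.
elim: nu a => [|m nu IHnu] a; first by case: a => [|[|a]].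
rewrite is_partition_cons => /and3P[m0 le_m part_nu].
case: a => [|a] add_a; rewrite [incr_nth _ _]/= is_partition_cons.
  by rewrite part_nu (leq_trans le_m).
rewrite m0 IHnu ?andbT //=; last by case: a add_a.
by rewrite nth_incr_nth; case: a add_a => [|a] //=; rewrite /addable /=; lia.
Qed.

Lemma is_partition_nth nu i : is_partition nu -> nth 0 nu i.+1 <= nth 0 nu i.
Proof.
elim: nu i => [|m nu IHnu] i; first by rewrite !nth_nil.
by rewrite is_partition_cons => /and3P[_ le_m part_nu]; case: i => [|i] //=; apply: IHnu.
Qed.

Lemma is_partition_pass x nu : is_partition nu -> is_partition (pass x nu).2.
Proof.
move=> part_nu; elim: x => //= a x; rewrite /offer; case: ifP => //= add_a px.
exact: is_partition_incr.
Qed.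

Ltac offer_cases :=
  match goal with |- context [offer ?a (?y, ?nu)] =>
    let c := fresh "c" in
    rewrite [offer a (y, nu)]/offer /=; case: (ifP (addable nu a)) => c
  end.

Ltac addable_split :=
  unfold addable in *; cbn [predn] in *;
  repeat match goal with
    H : context [nth 0 (incr_nth _ _) _] |- _ => rewrite nth_incr_nth in H
  end;
  try (exfalso; lia); split => //.

(** For a generating relation, either all its letters are rejected, which reproduces the relation
    with letters raised by one, or both sides leave the same word of rejected letters. *)
Lemma locplac_pass u v nu : is_partition nu -> locplac u v ->
  locplac (pass u nu).1 (pass v nu).1 /\ (pass u nu).2 = (pass v nu).2.
Proof.
move=> part_nu uv; elim: uv nu part_nu => {u v}
  [u|u v _ IH|v u w _ IH1 _ IH2|u u' v v' _ IHu _ IHv|a b ab|a|a] nu part_nu.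
- by [].
- by have [? ->] := IH nu part_nu; split => //; apply: locplac_sym.
- have [l1 ->] := IH1 nu part_nu; have [l2 ->] := IH2 nu part_nu.
  by split => //; apply: locplac_trans l1 l2.
- rewrite !pass_cat /=; have [l1 ->] := IHv nu part_nu.
  have [l2 ->] := IHu (pass v' nu).2 (is_partition_pass v' part_nu).
  by split => //; apply: locplac_cat.
- rewrite /pass /=; do !offer_cases; addable_split; try exact: incr_nthC.
  exact: locplac_far.
(* Row [a + 1] is no longer than row [a], so a letter [a + 1] read right after an accepted [a] is
   accepted; this excludes the inconsistent cases. *)
- have := is_partition_nth a part_nu.
  rewrite /pass /= => le_a; do !offer_cases; addable_split;
    try by rewrite ?(incr_nthC _ a.+1 a).
  exact: locplac_aba.
- have := is_partition_nth a part_nu.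
  rewrite /pass /= => le_a; do !offer_cases; addable_split;
    try by rewrite ?(incr_nthC _ a.+1 a).
  exact: locplac_bab.
Qed.

Lemma iter_step_pass y x nu :
  iter (size x) step (y ++ x, nu) = ((pass x nu).1 ++ y, (pass x nu).2).
Proof.
elim/last_ind: x y nu => [|x a IHx] y nu //=.
  by rewrite cats0.
rewrite size_rcons iterSr -rcons_cat step_rcons -cats1 pass_cat /pass /=.
rewrite /offer /=; case: ifP => _; first by rewrite IHx /= cats0.
by rewrite -cat_cons IHx /= -catA.
Qed.

Lemma size_step s : size s.1 <= (size (step s).1).+1.
Proof.
case: s => x nu; case/lastP: x => [|x a] //; rewrite step_rcons /offer size_rcons.
by case: ifP => _ //=; lia.
Qed.

Lemma size_iter_step N s : size s.1 <= size (iter N step s).1 + N.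
Proof.
elim: N => [|N IHN]; first by rewrite addn0.
by rewrite iterS; have := size_step (iter N step s); lia.
Qed.

Lemma ev_step s la : ev (step s) la <-> ev s la.
Proof.
split=> [[N evN]|[[|N] evN]]; first by exists N.+1; rewrite iterSr.
  by exists 0; rewrite /= in evN *; rewrite evN.
by exists N; rewrite -iterSr.
Qed.

Lemma ev_nil nu la : ev ([::], nu) la <-> nu = la.
Proof.
split=> [[N]|->]; last by exists 0.
by elim: N => [[]|N IHN] //; rewrite iterSr.
Qed.

Lemma ev_fun s la mu : ev s la -> ev s mu -> la = mu.
Proof.
case=> N; elim: N s => [s /= ->|N IHN s]; first by move/ev_nil.
by rewrite iterSr => /IHN evN /ev_step /evN.
Qed.

Lemma ev_pass x nu la : ev (x, nu) la <-> ev (pass x nu) la.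
Proof.
have -> : pass x nu = iter (size x) step (x, nu).
  by rewrite -[x in (x, nu)]cat0s iter_step_pass cats0 -surjective_pairing.
elim: (size x) => //= n ->; split; first by move/ev_step.
by move/ev_step.
Qed.

(** The two runs are compared after each full pass, where [locplac_pass] applies. A step removes at
    most one letter, so at least [size u] steps are available, and a pass over a nonempty word
    lowers [N]. *)
Lemma locplac_ev u v nu la : is_partition nu -> locplac u v -> ev (u, nu) la -> ev (v, nu) la.
Proof.
move=> part_nu uv [N]; elim/ltn_ind: N u v nu part_nu uv => N IHN u v nu part_nu uv evN.
have /perm_size eq_size := locplac_perm uv.
case: (posnP (size u)) => [/size0nil u0|u_gt0].
  move: uv evN eq_size; rewrite u0 => _ evN /esym/size0nil ->.
  by exists N.
have := size_iter_step N (u, nu); rewrite evN add0n /= => le_uN.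
apply/ev_pass; rewrite [pass v nu]surjective_pairing.
have [uv1 <-] := locplac_pass part_nu uv.
apply: (IHN (N - size u)) (is_partition_pass u part_nu) uv1 _; first by lia.
move: evN; rewrite -{1}(subnK le_uN) iterD -[u in (u, nu)]cat0s iter_step_pass.
by rewrite cats0.
Qed.

Lemma step_sim (h : seq nat * seq nat -> seq nat * seq nat)
    (inv : seq nat * seq nat -> Prop) N s :
    (forall s, inv s -> step (h s) = h (step s) /\ inv (step s)) ->
  inv s -> iter N step (h s) = h (iter N step s).
Proof.
move=> hinv; elim: N s => // N IHN s inv_s.
by have [hs inv_s1] := hinv s inv_s; rewrite !iterSr hs IHN.
Qed.

(* The extra box in the first row only matters for letters labeled 1. *)
Lemma ev_incr0 x nu la : all (leq 2) x ->
  ev (x, nu) la -> ev (x, incr_nth nu 0) (incr_nth la 0).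
Proof.
move=> x2 [N evN]; exists N.
have := @step_sim (fun s => (s.1, incr_nth s.2 0)) (fun s => all (leq 2) s.1) N (x, nu).
rewrite evN; apply=> // -[y mu] /=; case/lastP: y => [|y a] //.
rewrite all_rcons => /andP[a2 y2]; rewrite !step_rcons /offer /= /addable !nth_incr_nth.
have -> : (0 == a) = false by lia.
have -> : (0 == a.-1) = false by lia.
rewrite !add0n; case: ifP => _ //=; first by rewrite incr_nthC.
by rewrite y2 (leq_trans a2).
Qed.

Lemma pass_gt1 x nu : all (leq 2) (pass x nu).1.
Proof.
elim: x => //= a x IHx; rewrite /offer; case: ifP => //= na; rewrite IHx andbT.
by move: na; rewrite /addable; lia.
Qed.

(** The 0 is read at the end of the first pass. Rejected letters are positive, so all letters left
    by then are at least 2 and do not see the length of the first row. *)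
Lemma ev_cons0 x nu la : ev (x, nu) la -> ev (0 :: x, nu) (incr_nth la 0).
Proof.
move/ev_pass=> evx; apply/ev_pass => /=; rewrite /offer /=.
by apply: ev_incr0; rewrite ?pass_gt1 -?surjective_pairing.
Qed.

(** The new top row constrains only the letters that were 0 before the shift. Raised letters are
    never 0, so the old first row gains at most [count_mem 0 x] boxes and stays within [m]. *)
Lemma ev_shift m x nu la :
    nth 0 nu 0 + count_mem 0 x <= m ->
  ev (x, nu) la -> ev (map succn x, m :: nu) (m :: la).
Proof.
move=> le_m [N evN]; exists N.
have := @step_sim (fun s => (map succn s.1, m :: s.2))
  (fun s => nth 0 s.2 0 + count_mem 0 s.1 <= m) N (x, nu).
rewrite evN; apply=> // -[y mu] /=; case/lastP: y => [|y a] //.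
rewrite map_rcons !step_rcons -cats1 count_cat /= => le_y.
rewrite /offer /= /addable /=.
case: a le_y => [|a] le_y /=.
  by have -> /= : nth 0 mu 0 < m; [lia | rewrite nth_incr_nth /=; split=> //; lia].
case: ifP => _ /=; split=> //; last by lia.
by rewrite nth_incr_nth /=; lia.
Qed.

Lemma sumn_incr_nth nu a : sumn (incr_nth nu a) = (sumn nu).+1.
Proof.
elim: nu a => [|m nu IHnu] [|a] //=; last by rewrite IHnu addnS.
by elim: a => //= a ->.
Qed.

Lemma ev_partition x nu la : is_partition nu -> ev (x, nu) la ->
  is_partition la /\ sumn la = size x + sumn nu.
Proof.
move=> part_nu [N]; elim: N x nu part_nu => [|N IHN] x nu part_nu; first by case=> -> <-.
rewrite iterSr; case/lastP: x => [|x a]; first by move/IHN => /(_ part_nu) [].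
rewrite step_rcons /offer; case: ifP => [add_a|_] /IHN H; case: H => //.
- exact: is_partition_incr.
- by move=> pla ->; split => //; rewrite sumn_incr_nth size_rcons addnS.
- by move=> pla ->; split => //; rewrite size_rcons addSn.
Qed.

(** The word of 2's, 1's, 0's in weakly decreasing order with [nu] as its content; for a partition
    it is the label word of the tableau Z*. *)
Fixpoint zword (nu : seq nat) : seq nat :=
  if nu is m :: nu' then map succn (zword nu') ++ nseq m 0 else [::].

Lemma count0_zword nu : count_mem 0 (zword nu) = nth 0 nu 0.
Proof.
case: nu => //= m nu; rewrite count_cat count_nseq /= mul1n.
by rewrite count_map (eq_count (a2 := pred0)) ?count_pred0.
Qed.

Lemma ev_zeros x m nu la :
  ev (x, iter m (incr_nth^~ 0) nu) la -> ev (x ++ nseq m 0, nu) la.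
Proof.
elim: m nu => [|m IHm] nu; first by rewrite cats0.
rewrite iterSr => /IHm evm; apply/ev_step.
by rewrite -addn1 nseqD catA cats1 step_rcons.
Qed.

Lemma iter_incr0 m n nu : iter m (incr_nth^~ 0) (n :: nu) = (m + n) :: nu.
Proof. by elim: m => //= m ->. Qed.

Lemma ev_zword la : is_partition la -> ev (zword la, [::]) la.
Proof.
elim: la => [|m la IHla]; first by move=> _; apply/ev_nil.
rewrite is_partition_cons => /and3P[m0 le_m /IHla evla] /=.
apply: ev_zeros; rewrite -(prednK m0) iterSr /= iter_incr0 addn1 prednK //.
by apply: ev_shift evla; rewrite /= count0_zword.
Qed.

(** * Labelings and row insertion *)

Lemma ev_iter N s la : ev (iter N step s) la <-> ev s la.
Proof. by elim: N => //= N IHN; split=> [/ev_step|] /IHN // /ev_step. Qed.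

Lemma ev_nseq0 j x nu la :
  ev (x, nu) la -> ev (nseq j 0 ++ x, nu) (iter j (incr_nth^~ 0) la).
Proof. by move=> evx; elim: j => //= j IHj; apply: ev_cons0. Qed.

(** The empty partition accepts no positive letter, so the first [size x] steps move all of [x] to
    the front. *)
Lemma ev_rotate y x la : all (ltn 0) x ->
  ev (map succn x ++ y, [::]) la -> ev (y ++ x, [::]) la.
Proof.
move=> x_gt0 evx; apply/(ev_iter (size x)); rewrite iter_step_pass.
have -> // : pass x [::] = (map succn x, [::]).
elim: x x_gt0 {evx} => //= a x IHx /andP[a_gt0 /IHx ->].
by rewrite /offer /addable /= !nth_nil; case: a a_gt0.
Qed.

Fixpoint descends (k : nat) (z : seq nat) : bool :=
  if z is a :: q then (a == k.+1) && (k \in q) || descends k q else false.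

(** The trace of the labeling rule on labels alone: the first entry labeled [k + 1] stands left of
    one labeled [k]. Unlike being a cocharge word of a standard word, this makes sense for the
    intermediate words met in repeated catabolism. *)
Definition cocharge_valid (z : seq nat) : Prop :=
  forall k, k.+1 \in z -> descends k z.

Lemma descends_cat k u v :
  descends k (u ++ v) =
  [|| descends k u, descends k v | (k.+1 \in u) && (k \in v)].
Proof.
elim: u => [|a u IHu] /=; first by rewrite orbF.
rewrite IHu mem_cat inE [k.+1 == a]eq_sym.
by case: (a == k.+1); case: (k \in u); case: (k \in v); case: (descends k u);
  case: (descends k v); case: (k.+1 \in u).
Qed.

Lemma descends_mem k z : descends k z -> k.+1 \in z /\ k \in z.
Proof.
elim: z => //= a q IHq; rewrite !inE => /orP[/andP[/eqP-> ->]|/IHq[-> ->]].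
  by rewrite eqxx orbT.
by rewrite !orbT.
Qed.

Lemma descends_sorted k z : sorted leq z -> descends k z = false.
Proof.
elim: z => //= a q IHq aq; rewrite IHq ?(path_sorted aq) // orbF.
apply/negP => /andP[/eqP ak kq].
by have /allP/(_ _ kq) := order_path_min leq_trans aq; lia.
Qed.

Lemma descends_pred k z : all (ltn 0) z ->
  descends k (map predn z) = descends k.+1 z.
Proof.
elim: z => //= a q IHq /andP[a_gt0 q_gt0]; rewrite IHq //; congr (_ && _ || _).
  by case: a a_gt0.
rewrite -[k in LHS]/k.+1.-1 /=; apply/mapP/idP => [[b bq ->]|kq]; last by exists k.+1.
by rewrite prednK //; exact: (allP q_gt0).
Qed.

(** The far relation never exchanges [k] and [k + 1]; in the other two relations both sides have
    some [a + 1] before some [a]. *)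
Lemma locplac_descends k u v : locplac u v -> descends k u = descends k v.
Proof.
elim=> {u v} //= [v u w _ -> _ ->//|u u' v v' uu' IHu vv' IHv|a b ab|a|a].
- rewrite !descends_cat IHu IHv (perm_mem (locplac_perm uu')).
  by rewrite (perm_mem (locplac_perm vv')).
- by rewrite !inE; do !case: eqP => ? //=; exfalso; lia.
- by rewrite !inE; do !case: eqP => ? //=; exfalso; lia.
- by rewrite !inE; do !case: eqP => ? //=; exfalso; lia.
Qed.

Lemma locplac_valid u v : locplac u v -> cocharge_valid u -> cocharge_valid v.
Proof.
move=> uv valid_u k; rewrite -(perm_mem (locplac_perm uv)) -(locplac_descends k uv).
exact: valid_u.
Qed.

Lemma valid_lower z k j : cocharge_valid z -> k \in z -> j <= k -> j \in z.
Proof.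
move=> valid_z; elim: k => [|k IHk] kz; first by rewrite leqn0 => /eqP->.
rewrite leq_eqVlt => /predU1P[->//|]; apply: IHk.
by have /descends_mem[] := valid_z k kz.
Qed.

(* The labeling of w by l is compatible with reading w as the standardization
   of the word of its labels. *)
Definition stdlab (l : nat -> nat) (w : seq nat) : bool :=
  pairwise (fun x y => (x < y) == (l x <= l y)) w.

Lemma stdlabP (x y a b : nat) :
  reflect (x < y /\ a <= b \/ y <= x /\ b < a) ((x < y) == (a <= b)).
Proof. by case: ltnP => xy; case: leqP => ab; constructor; lia. Qed.

Lemma stdlab_sorted l r : stdlab l r -> sorted leq r -> sorted leq (map l r).
Proof.
rewrite /stdlab !(sorted_pairwise leq_trans) pairwise_map.
elim: r => //= a r IHr /andP[la stdr] /andP[lea ler]; rewrite IHr // andbT.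
apply/allP => x xr /=; move: (allP la x xr) (allP lea x xr) => /stdlabP + /=.
by case: ltngtP => // [|->]; lia.
Qed.

Lemma stdlab_uniq l w : stdlab l w -> uniq w.
Proof.
rewrite /stdlab uniq_pairwise; apply: sub_pairwise => x y /=.
by apply: contraTneq => ->; rewrite ltnn leqnn.
Qed.

Lemma stdlab_perm_mid l p u v q :
  perm_eq u v -> stdlab l v -> stdlab l (p ++ u ++ q) -> stdlab l (p ++ v ++ q).
Proof.
move=> uv; rewrite /stdlab !pairwise_cat !allrel_catr => ->.
rewrite (eq_allrel_meml _ _ (perm_mem uv)) (eq_allrel_memr _ _ (perm_mem uv)).
by case/and5P=> -> -> -> _ ->.
Qed.

(** As for Schensted insertion: [x] travels left through [r2] until it stands right behind [y], then
    [y] travels left through [r1]. Each move is a Knuth relation. *)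
Lemma locplac_bump r1 y r2 x :
    sorted leq (r1 ++ y :: r2) -> all (leq^~ x) r1 -> x < y ->
  locplac (rcons (r1 ++ y :: r2) x) (y :: r1 ++ x :: r2).
Proof.
move=> r_sorted r1x xy.
have right : locplac (y :: rcons r2 x) (y :: x :: r2).
  have [_ /=] := cat_sorted2 r_sorted.
  elim: r2 y {r1x r_sorted} xy => //= c r2 IHr2 y xy /andP[yc cr2].
  apply: locplac_trans (locplac_cons y (IHr2 c _ cr2)) _; first by lia.
  apply: (@locplac_catr [:: y; c; x] [:: y; x; c]).
  by apply/locplac_sym/locplac_yxz; rewrite xy.
rewrite rcons_cat /=; apply: locplac_trans (locplac_catl r1 right) _.
have -> : r1 ++ [:: y, x & r2] = (r1 ++ [:: y; x]) ++ r2 by rewrite -catA.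
have -> : y :: r1 ++ x :: r2 = (y :: rcons r1 x) ++ r2 by rewrite /= cat_rcons.
apply: locplac_catr.
have {right} : sorted leq (rcons r1 x).
  have [r1s _] := cat_sorted2 r_sorted.
  by case: r1 r1s r1x {r_sorted} => //= a s; rewrite rcons_path => -> /andP[ax sx];
    move: (mem_last a s); rewrite inE => /predU1P[->|/(allP sx)].
elim: r1 r1x {r_sorted} => //= b r1 IHr1 /andP[bx r1x] b_path.
apply: locplac_trans (locplac_cons b (IHr1 r1x (path_sorted b_path))) _.
case: r1 r1x b_path {IHr1} => [|e r1] /=; rewrite ?andbT => r1x.
  by move=> _; apply: locplac_xzy; rewrite bx.
case/andP=> be _; case/andP: r1x => ex _.
apply: (@locplac_catr [:: b; y; e] [:: y; b; e]).
by apply: locplac_xzy; rewrite be; lia.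
Qed.

Lemma perm_bump r i x : i < size r ->
  perm_eq (rcons r x) (nth 0 r i :: set_nth 0 r i x).
Proof.
move=> i_lt; rewrite set_nthE i_lt.
have {1}-> : r = take i r ++ nth 0 r i :: drop i.+1 r.
  by rewrite -drop_nth // cat_take_drop.
by apply/permP => p; rewrite -cats1 /= !count_cat /= addn0; lia.
Qed.

Lemma rowword_cons r T : rowword (r :: T) = rowword T ++ r.
Proof. by rewrite /rowword rev_cons flatten_rcons. Qed.

Lemma perm_row_insert T x :
  perm_eq (rcons (rowword T) x) (rowword (row_insert x T)).
Proof.
elim: T x => [|r T IHT] x //=; rewrite rowword_cons rcons_cat.
case: ltnP => [bumps|_]; rewrite rowword_cons //.
set i := find _ r in bumps *.
apply: (@perm_trans _ (rowword T ++ nth 0 r i :: set_nth 0 r i x)).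
  by rewrite perm_cat2l perm_bump.
by rewrite -cat_rcons perm_cat2r.
Qed.

Section RowBump.

Variables (l : nat -> nat) (r : seq nat) (x : nat).
Let i := find (ltn x) r.
Let y := nth 0 r i.
Let r' := set_nth 0 r i x.

Hypotheses (r_sorted : sorted leq r) (lab_rx : stdlab l (rcons r x)).
Hypothesis (bumps : i < size r).

(** The leftmost entry exceeding [x] is also, on labels, the leftmost one exceeding the label of
    [x]. Hence bumping entries performs the bump of [locplac_bump] on labels. *)
Lemma row_bump :
  [/\ sorted leq r', l x < l y, stdlab l (y :: r')
    & locplac (map l (rcons r x)) (map l (y :: r'))].
Proof.
have r_eq : r = take i r ++ y :: drop i.+1 r.
  by rewrite -drop_nth // cat_take_drop.
have r'_eq : r' = take i r ++ x :: drop i.+1 r by rewrite /r' set_nthE bumps.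
have xy : x < y by apply: (@nth_find _ 0 (ltn x)); rewrite has_find.
have r1x : all (leq^~ x) (take i r).
  apply/(all_nthP 0) => j; rewrite size_take bumps => ji.
  by rewrite nth_take //= leqNgt -[_ < _]/(ltn x _) (before_find 0 ji).
move: (take i r) (drop i.+1 r) r_eq r'_eq r1x => r1 r2 r_eq r'_eq r1x.
(* Entries left of the bumping position stand before [x] and do not exceed it, so compatibility
   bounds their labels. *)
have xr1 e : e \in r1 -> l e <= l x.
  move=> er1; have /allP/(_ e er1) /= ex := r1x.
  move: lab_rx; rewrite r_eq -cats1 -catA /stdlab pairwise_cat allrel_catr.
  case/and3P=> /andP[_ /allrelP/(_ e x er1 (mem_head _ _))/stdlabP]; move: ex.
  by case: ltngtP => // [|->]; lia.
have lxy : l x < l y.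
  move: lab_rx; rewrite r_eq -cats1 /stdlab pairwise_cat allrel1r all_cat /=.
  by case/and3P=> /and3P[_ /stdlabP]; lia.
move: r_sorted lab_rx; rewrite r'_eq r_eq.
move=> r_srt lab.
have lab_r : stdlab l (r1 ++ y :: r2).
  by move: lab; rewrite /stdlab -cats1 pairwise_cat => /and3P[].
split=> //.
- move: r_srt; rewrite !(sorted_pairwise leq_trans) !pairwise_cat !allrel_consr /=.
  case/and3P=> /andP[_ ->] -> /andP[yr2 ->]; rewrite r1x /= !andbT.
  by apply/allP => e /(allP yr2); apply: leq_trans; apply: ltnW.
- move: lab; rewrite /stdlab -cats1 -catA /= !pairwise_cat /= pairwise_cat /=.
  rewrite !allrel_consr !all_cat !allrel_catr !allrel1r /= !andbT.
  case/and3P=> /and3P[_ r12 ->] -> /andP[/andP[yr2 lyx] /andP[/andP[r2x _] pr2]].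
  rewrite r12 pr2 !andbT; apply/and3P; split=> //.
  + apply/and3P; split=> //; apply/allP => e er1.
    by apply/stdlabP; right; have /= := allP r1x e er1; have := xr1 e er1; lia.
  + have y_le e : e \in r2 -> y <= e.
      have [_ /= y_r2] := cat_sorted2 r_srt.
      exact: (allP (order_path_min leq_trans y_r2)).
    apply/allP => e er2; apply/stdlabP; left.
    by have /stdlabP := allP r2x e er2; have := y_le e er2; lia.
- rewrite map_rcons !map_cat /= map_cat /=; apply: locplac_bump => //.
    by have := stdlab_sorted lab_r r_srt; rewrite map_cat.
  by rewrite all_map; apply/allP.
Qed.

End RowBump.

Lemma stdlab_catl l u v : stdlab l (u ++ v) -> stdlab l u.
Proof. by rewrite /stdlab pairwise_cat => /and3P[]. Qed.

Lemma stdlab_catr l u v : stdlab l (u ++ v) -> stdlab l v.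
Proof. by rewrite /stdlab pairwise_cat => /and3P[]. Qed.

(** Here [w] is the part of the word still to be inserted; carrying it along also lets the induction
    treat a lower row followed by the finished upper rows. *)
Lemma row_insertP l T x w :
    all (sorted leq) T -> stdlab l (rowword T ++ x :: w) ->
  [/\ all (sorted leq) (row_insert x T),
      stdlab l (rowword (row_insert x T) ++ w)
    & locplac (map l (rcons (rowword T) x))
              (map l (rowword (row_insert x T)))].
Proof.
elim: T x w => [|r T IHT] x w /=; first by move=> _ lab; split.
case/andP=> r_sorted T_sorted; rewrite rowword_cons -catA => lab.
have lab_rx : stdlab l (rcons r x).
  by move: lab => /stdlab_catr; rewrite -cat_rcons => /stdlab_catl.
case: ltnP => [bumps|no_bump]; last first.
  rewrite /= T_sorted rowword_cons rcons_cat andbT -catA cat_rcons; split=> //.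
  rewrite (sorted_pairwise leq_trans) pairwise_rcons -(sorted_pairwise leq_trans).
  rewrite r_sorted andbT; apply/allP => e er /=; rewrite leqNgt.
  apply: contraL no_bump => xe; rewrite -ltnNge -has_find.
  by apply/hasP; exists e.
have [r'_sorted _ lab_r' lp_r'] := row_bump r_sorted lab_rx bumps.
have r'_perm := perm_bump x bumps.
set y := nth 0 r _ in r'_perm lab_r' lp_r' *.
set r' := set_nth 0 r _ x in r'_sorted r'_perm lab_r' lp_r' *.
have lab' : stdlab l (rowword T ++ y :: r' ++ w).
  rewrite -cat_cons; apply: stdlab_perm_mid r'_perm lab_r' _.
  by rewrite cat_rcons.
have [T'_sorted lab'' T'_lp] := IHT y (r' ++ w) T_sorted lab'.
rewrite /= r'_sorted T'_sorted rowword_cons -catA lab''; split=> //.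
rewrite rcons_cat map_cat; apply: locplac_trans (locplac_catl _ lp_r') _.
by rewrite -map_cat -cat_rcons !map_cat; apply: locplac_catr.
Qed.

Definition lab_count (l : nat -> nat) (k : nat) (w : seq nat) : nat :=
  count (fun x => l x == k) w.

(** The last two clauses serve the catabolism: all 0's are in the first row, and the 1's below it
    are few enough to meet the bound of [ev_shift]. *)
Definition tab_inv (l : nat -> nat) (T : seq (seq nat)) : Prop :=
  [/\ all (sorted leq) T, all (fun x => 0 < l x) (rowword (behead T))
    & lab_count l 1 (rowword (behead T)) <= lab_count l 0 (first_row T)].

(** A bumped entry has a larger label than the inserted one, hence a positive label. When a 1 leaves
    the first row, a 0 takes its place, so both counts grow together. *)
Lemma row_insert_inv l T x w :
    tab_inv l T -> stdlab l (rowword T ++ x :: w) -> tab_inv l (row_insert x T).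
Proof.
case: T => [|r T] [T_sorted pos le_count] lab; first by split.
have [sorted1 _ _] := row_insertP T_sorted lab.
move: sorted1 T_sorted pos le_count; rewrite /tab_inv /=; case: ltnP => /=; last first.
  move=> _ ? _ ? le_count; split=> //; apply: leq_trans le_count _.
  by rewrite /lab_count -cats1 count_cat leq_addr.
move=> bumps /andP[_ sorted1] /andP[r_sorted T_sorted] pos le_count.
have lab_rx : stdlab l (rcons r x).
  by move: lab; rewrite rowword_cons -catA => /stdlab_catr; rewrite -cat_rcons => /stdlab_catl.
have [r'_sorted lxy _ _] := row_bump r_sorted lab_rx bumps.
have /permP/(_ (fun z => l z == 0)) := perm_bump x bumps.
set y := nth 0 r _ in sorted1 lxy *; set r' := set_nth _ _ _ _ in r'_sorted *.
have perm_T := perm_row_insert T y; rewrite -(perm_all _ perm_T) all_rcons pos.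
rewrite /lab_count in le_count *; rewrite -(permP perm_T) -!cats1 !count_cat /= => count_r'.
by rewrite /= andbT r'_sorted sorted1; split=> //; lia.
Qed.

Lemma insertion_tableauP l w :
    stdlab l w ->
  let T := insertion_tableau w in
  [/\ tab_inv l T, stdlab l (rowword T), perm_eq w (rowword T)
    & locplac (map l w) (map l (rowword T))].
Proof.
rewrite /insertion_tableau /= -[w in stdlab l w]/(rowword [::] ++ w).
have : tab_inv l [::] by [].
rewrite -[w in perm_eq w]/(rowword [::] ++ w) -[w in map l w]/(rowword [::] ++ w).
elim: w [::] => [|x w IHw] T inv_T /= lab; first by rewrite cats0 in lab *.
have [T_sorted _ _] := inv_T.
have [_ lab' lp_T] := row_insertP T_sorted lab.
have [? ? perm_T lp_T'] := IHw _ (row_insert_inv inv_T lab) lab'.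
split=> //; rewrite -cat_rcons.
  by apply: perm_trans perm_T; rewrite perm_cat2r perm_row_insert.
apply: locplac_trans lp_T'; rewrite map_cat [map l (_ ++ w)]map_cat.
exact: locplac_catr.
Qed.

Lemma size_insertion_tableau l w :
  stdlab l w -> size (rowword (insertion_tableau w)) = size w.
Proof. by case/insertion_tableauP => _ _ /perm_size->. Qed.

(** * Catabolizability is computed by the process *)

Lemma sorted_zeros z : sorted leq z ->
  z = nseq (count_mem 0 z) 0 ++ drop (count_mem 0 z) z
  /\ all (ltn 0) (drop (count_mem 0 z) z).
Proof.
elim: z => // a z IHz az; have [z_eq z_gt0] := IHz (path_sorted az).
case: a az => [|a] az.
  by rewrite (_ : count_mem 0 (0 :: z) = (count_mem 0 z).+1) //= -z_eq.
have {}z_gt0 : all (ltn 0) z.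
  by apply/allP => x xz; have := allP (order_path_min leq_trans az) x xz => /=; lia.
suff -> : count_mem 0 (a.+1 :: z) = 0 by rewrite /= z_gt0.
by apply/count_memPn; rewrite inE /=; apply/negP => /(allP z_gt0).
Qed.

Lemma sumn_take_incr0 j k nu :
  sumn (take k (iter j (incr_nth^~ 0) nu)) <= j + sumn (take k nu).
Proof.
elim: j => //= j IHj; rewrite addSn; move: IHj; rewrite -ltnS; apply: leq_trans.
by case: (iter j _ nu) => [|m mu]; case: k => [|k] //=; rewrite ?take0.
Qed.

(** The sorted [r] has no descent. So a [k + 1] in it requires one in [s], which is lowered to [k]
    and now stands to its right; a lowered [k + 1] comes from a descent of [k + 2] to [k + 1]. *)
Lemma valid_cat_tab (m : nat) (s r : seq nat) :
    sorted leq r -> all (ltn 0) s -> m <= count_mem 0 r ->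
  cocharge_valid (s ++ r) -> cocharge_valid (drop m r ++ map predn s).
Proof.
move=> r_sorted s_gt0 le_m valid_sr k; rewrite descends_cat mem_cat.
case: (boolP (k.+1 \in drop m r)) => [kr _|kr /= /mapP[b bs kb]].
  have := valid_sr k; rewrite mem_cat (mem_drop kr) orbT descends_cat.
  rewrite (descends_sorted k r_sorted) /= => /(_ isT) ks.
  have {}ks : k.+1 \in s by case/orP: ks => [/descends_mem[]|/andP[]].
  by apply/or3P/Or33; apply/mapP; exists k.+1.
have b_eq : b = k.+2 by move: (allP s_gt0 b bs) => /=; lia.
have := valid_sr k.+1; rewrite mem_cat -b_eq bs descends_cat.
rewrite (descends_sorted _ r_sorted) -descends_pred //= => /(_ isT) /orP[->|].
  by rewrite orbT.
(* In the remaining case [k + 1] would lie among the first [m] letters of [r], which are zeros. *)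
have [r_eq _] := sorted_zeros r_sorted.
case/andP=> _; rewrite -[r in k.+1 \in r](cat_take_drop m) mem_cat (negPf kr) orbF.
by rewrite r_eq take_cat size_nseq ltn_neqAle le_m andbT; case: eqP => [->|_];
  rewrite ?subnn ?take0 ?cats0 ?take_nseq // mem_nseq andbF.
Qed.

Section CatTab.

Variables (l : nat -> nat) (w : seq nat).
Hypotheses (lab : stdlab l w) (valid : cocharge_valid (map l w)).

Let T := insertion_tableau w.
Let r := first_row T.
Let s := rowword (behead T).
Let c := lab_count l 0 r.

Lemma rowword_first_row : rowword T = s ++ r.
Proof. by rewrite /s /r; case: T => //= r0 T0; rewrite rowword_cons. Qed.

Let lab_sr : stdlab l (s ++ r).
Proof. by have [_ + _ _] := insertion_tableauP lab; rewrite -/T rowword_first_row. Qed.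

Let perm_sr : perm_eq w (s ++ r).
Proof. by have [_ _ + _] := insertion_tableauP lab; rewrite -/T rowword_first_row. Qed.

Let locplac_sr : locplac (map l w) (map l s ++ map l r).
Proof.
by have [_ _ _] := insertion_tableauP lab; rewrite -/T rowword_first_row map_cat.
Qed.

Let valid_sr : cocharge_valid (map l s ++ map l r).
Proof. exact: locplac_valid locplac_sr valid. Qed.

Let s_gt0 : all (ltn 0) (map l s).
Proof. by have [[_ pos _] _ _ _] := insertion_tableauP lab; rewrite all_map. Qed.

Let r_sorted : sorted leq r.
Proof.
have [[T_sorted _ _] _ _ _] := insertion_tableauP lab.
by rewrite /r /T; case: (insertion_tableau w) T_sorted => //= r0 T0 /andP[].
Qed.

Let lr_sorted : sorted leq (map l r).
Proof. exact: stdlab_sorted (stdlab_catr lab_sr) r_sorted. Qed.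

Let c_eq : c = count_mem 0 (map l r).
Proof. by rewrite count_map. Qed.

Lemma map_first_row :
  map l r = nseq c 0 ++ map l (drop c r) /\ all (ltn 0) (map l (drop c r)).
Proof. by have := sorted_zeros lr_sorted; rewrite -c_eq map_drop. Qed.

Lemma lab_take e : e \in take c r -> l e = 0.
Proof.
move=> /(map_f l); rewrite map_take map_first_row.1 take_cat size_nseq ltnn subnn.
by rewrite take0 cats0 mem_nseq => /andP[_ /eqP].
Qed.

Lemma cat_sr : s ++ r = s ++ take c r ++ drop c r.
Proof. by rewrite cat_take_drop. Qed.

Lemma first_row_smallest :
  sort leq (rowword T) = take c r ++ sort leq (s ++ drop c r).
Proof.
rewrite rowword_first_row; apply: (sorted_eq leq_trans anti_leq).
- exact: sort_sorted leq_total _.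
- rewrite (sorted_pairwise leq_trans) pairwise_cat -!(sorted_pairwise leq_trans).
  rewrite (sort_sorted leq_total) take_sorted // !andbT.
  apply/allrelP => x y xt; rewrite mem_sort mem_cat => yin.
  have lx := lab_take xt; have := lab_sr; rewrite cat_sr /stdlab !pairwise_cat allrel_catr.
  case/and3P=> /andP[/allrelP sx _] _ /and3P[/allrelP xd _ _].
  case/orP: yin => [ys|yd].
    have /stdlabP := sx y x ys xt; rewrite lx.
    by have := allP s_gt0 _ (map_f l ys) => /=; lia.
  have /stdlabP := xd x y xt yd; rewrite lx.
  by have := allP map_first_row.2 _ (map_f l yd) => /=; lia.
- rewrite perm_sort {1}cat_sr; apply: (@perm_trans _ (take c r ++ s ++ drop c r)).
    by rewrite perm_catCA.
  by rewrite perm_cat2l perm_sym perm_sort.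
Qed.

(** If [m > c], a positive label occurs in the first row, so by validity a label 1 occurs in a lower
    row, at an entry [f]. The smallest entry [e] of positive label is at most [f] and would lie in
    the first row, after [f]; compatibility then forces label 0 on [e]. *)
Lemma smallest_le m : m <= size r ->
  all (mem (take m r)) (take m (sort leq (rowword T))) = (m <= c).
Proof.
move=> le_m; rewrite first_row_smallest; apply/idP/idP => [all_m|le_mc]; last first.
  have c_le : c <= size r by exact: count_size.
  rewrite take_cat size_takel //.
  case: ltnP => [m_lt|c_ge]; first by rewrite take_takel ?(ltnW m_lt) //; apply/allP.
  have -> : m = c by lia.
  by rewrite subnn take0 cats0; apply/allP.
rewrite leqNgt; apply/negP => c_lt.
have d_size : 0 < size (drop c r) by rewrite size_drop; lia.
have one_sr : 1 \in map l s ++ map l r.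
  apply: (@valid_lower _ (l (nth 0 (drop c r) 0))) => //.
    by rewrite mem_cat (map_f l (mem_drop (mem_nth 0 d_size))) orbT.
  exact: (allP map_first_row.2 _ (map_f l (mem_nth 0 d_size))).
have {one_sr} : 1 \in map l s.
  have := valid_sr one_sr; rewrite descends_cat (descends_sorted _ lr_sorted) /=.
  by case/orP=> [/descends_mem[]|/andP[]].
case/mapP=> f fs /esym lf.
set q := sort leq (s ++ drop c r) in all_m.
have q_size : 0 < size q by rewrite size_sort size_cat; lia.
pose e := nth 0 q 0.
have e_le : e <= f.
  have : f \in q by rewrite mem_sort mem_cat fs.
  have : sorted leq q by apply: sort_sorted leq_total _.
  rewrite /e; case: q {all_m q_size e} => //= a q /(order_path_min leq_trans)/allP a_le.
  by rewrite inE => /predU1P[->//|/a_le].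
have er : e \in r.
  apply: (@mem_take m); apply: (allP all_m).
  rewrite take_cat size_takel ?count_size // ltnNge (ltnW c_lt) /= mem_cat; apply/orP; right.
  rewrite /e; case: q q_size {all_m e e_le} => //= a q _.
  by case: (m - c) (subn_gt0 c m) => [|k] /=; rewrite ?c_lt ?inE ?eqxx.
have le_gt0 : 0 < l e.
  have eq : e \in q by rewrite mem_nth.
  move: eq; rewrite mem_sort mem_cat => /orP[es|ed].
    exact: (allP s_gt0 _ (map_f l es)).
  exact: (allP map_first_row.2 _ (map_f l ed)).
move: lab_sr; rewrite /stdlab pairwise_cat => /and3P[/allrelP/(_ f e fs er)/stdlabP].
by rewrite lf; lia.
Qed.

(* Moving the rest of the first row to the front of the word keeps its labels;
   deleting the m smallest entries lowers the labels of the other rows. *)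
Definition cat_label (x : nat) : nat := if x \in r then l x else (l x).-1.

Definition cat_word (m : nat) : seq nat := drop m r ++ s.

Lemma map_cat_word m :
  map cat_label (cat_word m) = drop m (map l r) ++ map predn (map l s).
Proof.
rewrite /cat_word map_cat -map_drop -map_comp; congr (_ ++ _).
  by apply/eq_in_map => x /mem_drop xr; rewrite /cat_label xr.
apply/eq_in_map => x xs; rewrite /cat_label /=.
have := stdlab_uniq lab_sr; rewrite cat_uniq => /and3P[_ /hasPn nr _].
by case: ifP => // /nr /=; rewrite xs.
Qed.

(** When an entry of [s] passes from before to after an entry of the first row, the weak and strict
    label inequalities change places; lowering the labels on [s] by one compensates exactly. *)
Lemma stdlab_cat_word m : stdlab cat_label (cat_word m).
Proof.
have := stdlab_uniq lab_sr; rewrite cat_uniq => /and3P[_ /hasPn nr _].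
have lab_s x : x \in s -> cat_label x = (l x).-1.
  by move=> xs; rewrite /cat_label; case: ifP => // /nr /=; rewrite xs.
have lab_r x : x \in drop m r -> cat_label x = l x.
  by move=> /mem_drop xr; rewrite /cat_label xr.
have gt0 x : x \in s -> 0 < l x by move=> xs; exact: (allP s_gt0 _ (map_f l xs)).
have := lab_sr; rewrite -[r in s ++ r](cat_take_drop m) /stdlab !pairwise_cat allrel_catr.
case/and3P=> /andP[_ /allrelP sd] ps /and3P[_ _ pd].
apply/and3P; split.
- apply/allrelP => x y xd ys; rewrite lab_r // lab_s //; apply/stdlabP.
  have /stdlabP := sd y x ys xd; have := gt0 y ys.
  have : x != y by apply: contraL ys => /eqP<-; apply: nr (mem_drop xd).
  by lia.
- apply: (sub_in_pairwise (P := [in drop m r]) _ (allss _) pd).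
  by move=> x y xd yd /=; rewrite !lab_r.
- apply: (sub_in_pairwise (P := [in s]) _ (allss _) ps) => x y xs ys /stdlabP xy.
  rewrite /= !lab_s //; apply/stdlabP.
  by have := gt0 x xs; have := gt0 y ys; lia.
Qed.

Lemma first_row_label0 : w != [::] -> 0 < c.
Proof.
move=> w_n0; have [x xw] : exists x, x \in w.
  by case: (w) w_n0 => // x u _; exists x; rewrite mem_head.
have := valid_lower valid (map_f l xw) (leq0n _).
rewrite (perm_mem (locplac_perm locplac_sr)) mem_cat.
case: (boolP (0 \in map l s)) => [/(allP s_gt0)//|_ /=].
by rewrite c_eq -has_count has_pred1.
Qed.

(** The positive labels of the first row are rejected, then its [c] zeros build a row of length [c].
    The word left is the label word of the catabolism shifted by one, so [ev_shift] applies, with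
    its bound given by [tab_inv]. *)
Lemma ev_cat_word la : 0 < c ->
  ev (map cat_label (cat_word c), [::]) la -> ev (map l w, [::]) (c :: la).
Proof.
move=> c_gt0; rewrite map_cat_word -map_drop => ev_la.
apply: (locplac_ev _ (locplac_sym locplac_sr)) => //.
have [r_eq d_gt0] := map_first_row; rewrite r_eq catA; apply: ev_rotate => //.
rewrite catA; apply: ev_zeros; rewrite -(prednK c_gt0) iterSr /= iter_incr0 addn1 prednK //.
have -> : map l s = map succn (map predn (map l s)).
  apply/esym; rewrite -map_comp; apply: map_id_in => x /(allP s_gt0) /=.
  exact: prednK.
rewrite -map_cat; apply: ev_shift ev_la; rewrite /= count_cat.
have -> : count_mem 0 (map l (drop c r)) = 0.
  by apply/count_memPn/negP => /(allP d_gt0).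
rewrite !add0n !count_map; have [[_ _ le_count] _ _ _] := insertion_tableauP lab.
apply: leq_trans le_count; rewrite -/T -/s /lab_count; apply: eq_leq.
apply: eq_in_count => x xs /=; have := allP s_gt0 _ (map_f l xs) => /=.
by case: (l x) => [|[|k]].
Qed.

Lemma map_cat_word_nseq m : m <= c ->
  map cat_label (cat_word m) = nseq (c - m) 0 ++ map cat_label (cat_word c).
Proof.
move=> le_m; rewrite !map_cat_word catA; congr (_ ++ _).
by rewrite -[in RHS]map_drop [in LHS]map_first_row.1 drop_cat size_nseq; case: ltnP => [_|c_le];
  [rewrite drop_nseq | have -> : m = c by apply/eqP; rewrite eqn_leq le_m];
  rewrite ?subnn ?drop0.
Qed.

Lemma size_cat_word m : 0 < m <= c -> size (cat_word m) < size w.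
Proof.
case/andP=> m_gt0 le_m; have c_le : c <= size r by exact: count_size.
rewrite (perm_size perm_sr) /cat_word !size_cat size_drop addnC ltn_add2l.
by rewrite ltn_subrL m_gt0 (leq_trans m_gt0 (leq_trans le_m c_le)).
Qed.

Lemma valid_cat_word m : m <= c -> cocharge_valid (map cat_label (cat_word m)).
Proof. by move=> le_m; rewrite map_cat_word; apply: valid_cat_tab; rewrite -?c_eq. Qed.

End CatTab.

(** The greedy choice [m = c] is the one made by the process. A smaller [m] leaves [c - m] zeros in
    front of the next word, and by [ev_nseq0] these only lengthen the first row of the next
    result. *)
Lemma catabolizable_max l w : stdlab l w -> cocharge_valid (map l w) ->
  exists la, [/\ ev (map l w, [::]) la,
    catabolizable la (insertion_tableau w)
  & forall mu, 0 \notin mu -> catabolizable mu (insertion_tableau w) ->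
    forall k, sumn (take k mu) <= sumn (take k la)].
Proof.
have [n] := ubnP (size w); elim: n w l => // n IHn w l le_n lab valid.
have [w0|w_n0] := eqVneq w [::].
  exists [::]; split; rewrite w0 //; first exact/ev_nil.
  by case=> // m mu; rewrite inE negb_or /= leqn0 [0 == m]eq_sym => /andP[/negPf->].
set T := insertion_tableau w; set c := lab_count l 0 (first_row T).
have c_gt0 : 0 < c := first_row_label0 lab valid w_n0.
have IH m : 0 < m <= c -> exists la,
    [/\ ev (map (cat_label l w) (cat_word w m), [::]) la,
    catabolizable la (cat_tab m T)
  & forall mu, 0 \notin mu -> catabolizable mu (cat_tab m T) ->
    forall k, sumn (take k mu) <= sumn (take k la)].
  move=> m_c; apply: IHn; first by have := size_cat_word lab m_c; lia.
    exact: stdlab_cat_word.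
  by apply: valid_cat_word => //; case/andP: m_c.
have [|la [ev_la cat_la max_la]] := IH c; first by rewrite c_gt0 leqnn.
have c_le : c <= size (first_row T) by exact: count_size.
exists (c :: la); split; first exact: ev_cat_word.
  by rewrite /= c_le (smallest_le lab valid) // leqnn.
case=> // m mu; rewrite inE negb_or /= eq_sym -lt0n => /andP[m_gt0 mu0].
case/and3P=> le_m; rewrite (smallest_le lab valid) // => le_mc cat_mu [|k] //=.
have [|la' [ev_la' _ max_la']] := IH m; first by rewrite m_gt0.
have la'_eq : la' = iter (c - m) (incr_nth^~ 0) la.
  apply: (ev_fun ev_la'); rewrite (map_cat_word_nseq lab le_mc).
  exact: ev_nseq0.
(* Partial sums of [la'] exceed those of [la] by at most [c - m], exactly what the first part [m]
   lacks compared with [c]. *)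
have := max_la' mu mu0 cat_mu k; rewrite la'_eq => le_mu.
rewrite -{1}[c](subnKC le_mc) -addnA leq_add2l.
exact: leq_trans le_mu (sumn_take_incr0 _ _ _).
Qed.

(** Antisymmetry of dominance, with [k] in the finite range tested by [dominates]. *)
Lemma sumn_take_inj (la mu : seq nat) : 0 \notin la -> 0 \notin mu ->
    (forall k, k <= size la + size mu -> sumn (take k la) = sumn (take k mu)) ->
  la = mu.
Proof.
elim: la mu => [|m la IHla] [|n mu] //=; rewrite !inE ?negb_or => la0 mu0 eq_take.
- by have := eq_take 1; rewrite /= take0 /=; lia.
- by have := eq_take 1; rewrite /= take0 /=; lia.
have mn : m = n by have := eq_take 1; rewrite /= !take0 /=; lia.
move: la0 mu0 => /andP[_ la0] /andP[_ mu0].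
by rewrite mn (IHla mu) // => k le_k; have := eq_take k.+1; rewrite /= mn; lia.
Qed.

Lemma ctype_unique la w :
    is_partition la -> sumn la = size (rowword (insertion_tableau w)) ->
    catabolizable la (insertion_tableau w) ->
    (forall mu, 0 \notin mu -> catabolizable mu (insertion_tableau w) ->
      forall k, sumn (take k mu) <= sumn (take k la)) ->
  ctype w = la.
Proof.
set T := insertion_tableau w => part_la sum_la cat_la max_la.
rewrite /ctype /ctype_tab -/T; set L := catabolizable_partitions T.
have memL mu : (mu \in L) =
    [&& is_partition mu, sumn mu == size (rowword T) & catabolizable mu T].
  by rewrite mem_filter mem_partitions andbC andbA.
have laL : la \in L by rewrite memL part_la sum_la eqxx.
have la_max : all (fun mu => dominates mu la ==> (mu == la)) L.
  apply/allP => mu; rewrite memL => /and3P[/andP[_ mu0] _ cat_mu].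
  apply/implyP => /allP dom; apply/eqP.
  have le_mu := max_la mu mu0 cat_mu.
  apply: sumn_take_inj => // [|k le_k]; first by case/andP: part_la.
  apply/eqP; rewrite eqn_leq le_mu dom // mem_iota; lia.
case L_eq: [seq _ <- L | _] => [|mu s] /=.
  by have := mem_filter (fun la => all (fun mu => dominates mu la ==> (mu == la)) L) la L;
    rewrite L_eq la_max laL.
(* The head [mu] chosen by [ctype_tab] is itself maximal, and [la] dominates it, so the two
   agree. *)
have : mu \in mu :: s by rewrite mem_head.
rewrite -L_eq mem_filter => /andP[/allP/(_ la laL)/implyP mu_max].
rewrite memL => /and3P[/andP[_ mu0] _ cat_mu]; apply/esym/eqP/mu_max.
by apply/allP => k _; apply: max_la.
Qed.

Lemma ctype_ev l w : stdlab l w -> cocharge_valid (map l w) ->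
  ev (map l w, [::]) (ctype w) /\ is_partition (ctype w).
Proof.
move=> lab valid; have [la [ev_la cat_la max_la]] := catabolizable_max lab valid.
have [//|part_la sum_la] := ev_partition _ ev_la.
have -> // : ctype w = la.
apply: ctype_unique => //; rewrite (size_insertion_tableau lab) sum_la size_map.
exact: addn0.
Qed.

(** * Cocharge labelings of standard words *)

Lemma standard_uniq w : is_standard w -> uniq w.
Proof. by move=> /perm_uniq->; apply: iota_uniq. Qed.

Lemma mem_standard w x : is_standard w -> (x \in w) = (0 < x <= size w).
Proof. by move=> /perm_mem->; rewrite mem_iota; lia. Qed.

Lemma perm_standard u v : perm_eq u v -> is_standard u -> is_standard v.
Proof.
move=> uv; rewrite /is_standard -(perm_size uv); apply: perm_trans.
by rewrite perm_sym.
Qed.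

Lemma cocharge_labelS w k : 0 < k ->
  cocharge_label w k.+1 = cocharge_label w k + (index k.+1 w < index k w).
Proof. by case: k. Qed.

Lemma cocharge_label_succ w k :
  cocharge_label w k <= cocharge_label w k.+1 <= (cocharge_label w k).+1.
Proof. case: k => // k; rewrite (@cocharge_labelS w k.+1) //.
by case: (index _ _ < _); rewrite ?addn1 ?addn0 leqnn ?leqnSn.
Qed.

Lemma cocharge_label_mono w x y : x <= y -> cocharge_label w x <= cocharge_label w y.
Proof.
elim: y => [|y IHy]; first by rewrite leqn0 => /eqP->.
rewrite leq_eqVlt => /predU1P[->//|/IHy le_x]; apply: leq_trans le_x _.
by case/andP: (cocharge_label_succ w y).
Qed.

Lemma cocharge_label_lt w x y : cocharge_label w x < cocharge_label w y -> x < y.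
Proof. by rewrite !ltnNge; apply: contra; apply: cocharge_label_mono. Qed.

Lemma cocharge_label_index w x y : 0 < x -> x <= y ->
  cocharge_label w y = cocharge_label w x -> index x w <= index y w.
Proof.
move=> x_gt0; elim: y => [|y IHy]; first by case: x x_gt0.
rewrite leq_eqVlt => /predU1P[->//|]; rewrite ltnS => xy eq_l.
have := cocharge_label_mono w xy.
move: eq_l; rewrite cocharge_labelS; last by lia.
case: ltnP => [_|le_yy]; first by lia.
by rewrite addn0 => eq_l _; apply: leq_trans (IHy xy eq_l) le_yy.
Qed.

(** Labels grow weakly with the entries, and entries with equal labels increase from left to
    right. *)
Lemma stdlab_standard w : is_standard w -> stdlab (cocharge_label w) w.
Proof.
move=> std_w; have uniq_w := standard_uniq std_w; apply/(pairwiseP 0) => i j.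
rewrite !inE => i_lt j_lt ij; set x := nth 0 w i; set y := nth 0 w j.
have [x_in y_in] : x \in w /\ y \in w by rewrite !mem_nth.
have [x_gt0 y_gt0] : 0 < x /\ 0 < y.
  by move: x_in y_in; rewrite !(mem_standard _ std_w); lia.
have xy_n : x != y by rewrite nth_uniq //; lia.
apply/stdlabP; case: (ltnP x y) => xy.
  by left; split=> //; apply: cocharge_label_mono; lia.
right; split=> //; rewrite ltn_neqAle cocharge_label_mono // andbT.
apply/negP => /eqP/esym eq_l; have := cocharge_label_index y_gt0 xy eq_l.
by rewrite !index_uniq //; lia.
Qed.

Lemma descends_index (l : nat -> nat) (w : seq nat) k x y : x \in w -> y \in w ->
  index x w < index y w -> l x = k.+1 -> l y = k -> descends k (map l w).
Proof.
move=> + + + lx ly; elim: w => //= a w IHw; rewrite !inE.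
case: eqVneq => [ax _|ax /= xw]; case: eqVneq => [ay _ //|ay /= yw] // lt_xy.
  by rewrite -lx -ly ax eqxx map_f.
by rewrite IHw ?orbT.
Qed.

Lemma valid_standard w : is_standard w -> cocharge_valid (cocharge_word w).
Proof.
move=> std_w k /mapP[x xw /esym lx].
(* Going down from [x], [i] is the place where the label jumps from [k] to [k + 1]; there [i + 1]
   stands left of [i]. *)
have [i [i_gt0 i_lt li li1 idx]] : exists i, [/\ 0 < i, i < x,
    cocharge_label w i = k, cocharge_label w i.+1 = k.+1 &
    index i.+1 w < index i w].
  elim: x lx {xw} => // x IHx; case: x IHx => // x IHx.
  rewrite cocharge_labelS //; case: ltnP => [idx|_]; last first.
    by rewrite addn0 => /IHx[i [? ? ? ? ?]]; exists i; split=> //; apply: ltnW.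
  rewrite addn1 => /succn_inj lx; exists x.+1; split=> //.
  by rewrite (@cocharge_labelS w x.+1) // idx addn1 lx.
have [x0 xn] : 0 < x /\ x <= size w by move: xw; rewrite mem_standard //; lia.
by apply: (descends_index _ _ idx); rewrite ?mem_standard //; lia.
Qed.

Lemma ctype_cocharge w : is_standard w ->
  ev (cocharge_word w, [::]) (ctype w) /\ is_partition (ctype w).
Proof.
by move=> std_w; apply: ctype_ev; [apply: stdlab_standard | apply: valid_standard].
Qed.

Lemma ltn_index_swap (p : seq nat) a b q x y :
    ~~ ((x == a) && (y == b)) -> ~~ ((x == b) && (y == a)) ->
  (index x (p ++ [:: a; b] ++ q) < index y (p ++ [:: a; b] ++ q)) =
  (index x (p ++ [:: b; a] ++ q) < index y (p ++ [:: b; a] ++ q)).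
Proof.
elim: p => [|c p IHp] /=; last by case: (c == x); case: (c == y); rewrite // !ltnS.
rewrite !(eq_sym x) !(eq_sym y).
by case: (a == x); case: (b == x); case: (a == y); case: (b == y).
Qed.

Definition consecutive (a b : nat) : bool := (a == b.+1) || (b == a.+1).

(** The labeling depends only on the relative positions of [i] and [i + 1] for each [i], which the
    exchange of [a] and [b] leaves alone. *)
Lemma cocharge_label_swap p a b q : ~~ consecutive a b ->
  cocharge_label (p ++ [:: a; b] ++ q) =1 cocharge_label (p ++ [:: b; a] ++ q).
Proof.
rewrite /consecutive => cons; case=> // k; elim: k => // k IHk.
rewrite !(@cocharge_labelS _ k.+1) // IHk; congr (_ + _); congr nat_of_bool.
by apply: ltn_index_swap; lia.
Qed.

Lemma cocharge_swap w p a b q (l := cocharge_label w) :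
    is_standard w -> w = p ++ [:: a; b] ++ q -> ~~ consecutive a b ->
  is_standard (p ++ [:: b; a] ++ q) /\
  cocharge_word (p ++ [:: b; a] ++ q) = map l p ++ [:: l b; l a] ++ map l q.
Proof.
move=> std_w w_eq cons; split.
  apply: perm_standard std_w; rewrite w_eq perm_cat2l perm_cat2r.
  by apply/permP => c /=; lia.
have -> : map l p ++ [:: l b; l a] ++ map l q = map l (p ++ [:: b; a] ++ q).
  by rewrite !map_cat.
by apply: eq_map => x; rewrite /l w_eq (cocharge_label_swap _ _ cons).
Qed.

(** Moving [a] to the front affects only its comparisons with [a - 1] and [a + 1]: the label rises
    one more on reaching [a] and one less on leaving it, so only the label of [a] changes. *)
Lemma cocharge_corotation w a (l := cocharge_label (rcons w a)) :
    is_standard (rcons w a) -> 0 < l a ->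
  [/\ a != 1, is_standard (a :: w) & cocharge_word (a :: w) = (l a).+1 :: map l w].
Proof.
move=> std_wa la_gt0; have uniq_wa := standard_uniq std_wa.
have a_n1 : a != 1 by apply: contraL la_gt0 => /eqP ->.
have std_aw : is_standard (a :: w) by apply: perm_standard std_wa; rewrite perm_rcons.
split=> //.
have idx_a : index a (rcons w a) = size w.
  move: uniq_wa; rewrite rcons_uniq -cats1 index_cat => /andP[/negPf-> _] /=.
  by rewrite eqxx addn0.
have label_eq k : 0 < k <= size (rcons w a) ->
    cocharge_label (a :: w) k = l k + (k == a).
  elim: k => // k IHk /andP[_ k_lt].
  have [->|k_n0] := eqVneq k 0; first by rewrite [1 == a]eq_sym (negPf a_n1).
  have k_in : k \in rcons w a by rewrite mem_standard //; lia.
  have k1_in : k.+1 \in rcons w a by rewrite mem_standard //; lia.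
  rewrite /l !(@cocharge_labelS _ k) ?lt0n // IHk; last by lia.
  rewrite -/(l k) -!addnA; congr (_ + _).
  have [ka|ka] := eqVneq k a.
    have k1w : k.+1 \in w by move: k1_in; rewrite mem_rcons inE ka; case: eqP => //; lia.
    rewrite ka in k1w *; rewrite idx_a -cats1 index_cat k1w index_mem k1w /= eqxx.
    by rewrite (gtn_eqF (ltnSn a)).
  have kw : k \in w by move: k_in; rewrite mem_rcons inE (negPf ka).
  have [k1a|k1a] := eqVneq k.+1 a.
    rewrite k1a idx_a /= eqxx eq_sym (negPf ka) -cats1 index_cat kw /=.
    by rewrite ltnNge ltnW ?index_mem.
  have k1w : k.+1 \in w by move: k1_in; rewrite mem_rcons inE (negPf k1a).
  rewrite /= !(eq_sym a) (negPf ka) (negPf k1a) -cats1 !index_cat kw k1w ltnS.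
  by rewrite addn0.
rewrite /cocharge_word /= label_eq ?eqxx ?addn1; last first.
  by rewrite -mem_standard // mem_rcons mem_head.
congr (_ :: _); apply/eq_in_map => x xw; rewrite label_eq; last first.
  by rewrite -mem_standard // mem_rcons inE xw orbT.
case: eqP => [xa|_]; last by rewrite addn0.
by move: uniq_wa; rewrite rcons_uniq -xa xw.
Qed.

Lemma count_standard w x : is_standard w -> x \in w -> count (gtn x) w = x.-1.
Proof.
move=> std_w xw; have := xw; rewrite mem_standard // (permP std_w) => x_in.
have -> : size w = x.-1 + (size w - x.-1) by lia.
rewrite iotaD count_cat (@eq_in_count _ _ predT (iota 1 _)); last first.
  by move=> y; rewrite mem_iota /= => y_in; apply/idP; lia.
rewrite count_predT size_iota (@eq_in_count _ _ pred0 (iota _ _)); last first.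
  by move=> y; rewrite mem_iota /= => y_in; apply/negbTE; rewrite -leqNgt; lia.
by rewrite count_pred0 addn0.
Qed.

(** By compatibility the labels decide which of two positions holds the larger entry; [rank] records
    this. An entry of a standard word is one more than the number of smaller entries. *)
Lemma cocharge_word_inj u v : is_standard u -> is_standard v ->
  cocharge_word u = cocharge_word v -> u = v.
Proof.
move=> std_u std_v eq_uv; have size_uv : size u = size v.
  by rewrite -(size_map (cocharge_label u)) -/(cocharge_word u) eq_uv size_map.
pose rank (z : seq nat) i j := if j < i then nth 0 z j <= nth 0 z i
  else (j != i) && ~~ (nth 0 z i <= nth 0 z j).
suff nth_rank w i : is_standard w -> i < size w ->
    nth 0 w i = (count (rank (cocharge_word w) i) (iota 0 (size w))).+1.
  apply: (@eq_from_nth _ 0) => // i i_lt.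
  by rewrite !nth_rank -?size_uv // eq_uv.
move=> std_w i_lt; have wi : nth 0 w i \in w by rewrite mem_nth.
have -> : count (rank (cocharge_word w) i) (iota 0 (size w)) = count (gtn (nth 0 w i)) w.
  have -> p : count p w = count (fun j => p (nth 0 w j)) (iota 0 (size w)).
    by rewrite -{1}(mkseq_nth 0 w) count_map.
  apply: eq_in_count => j.
  rewrite mem_iota add0n /= /rank => j_lt.
  have lab := pairwiseP 0 (stdlab_standard std_w).
  rewrite /cocharge_word !(nth_map 0) //.
  case: ltngtP => [ji|ij|->] /=; last by rewrite ltnn.
    by rewrite (eqP (lab j i _ _ ji)).
  rewrite -(eqP (lab i j _ _ ij)) // -leqNgt leq_eqVlt.
  by rewrite nth_uniq ?standard_uniq // gtn_eqF.
rewrite count_standard // prednK //.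
by move: wi; rewrite mem_standard // => /andP[].
Qed.

Lemma locplac_central q a : let c := nseq q a.+1 ++ nseq q a in
  locplac (a :: c) (rcons c a) /\ locplac (a.+1 :: c) (rcons c a.+1).
Proof.
elim: q => [|q [IHa IHb]]; first by split.
set c := nseq q a.+1 ++ nseq q a in IHa IHb *.
have c_eq : locplac (nseq q.+1 a.+1 ++ nseq q.+1 a) (c ++ [:: a.+1; a]).
  have -> : nseq q.+1 a.+1 ++ nseq q.+1 a = (a.+1 :: c) ++ [:: a].
    by rewrite -[in nseq q.+1 a]addn1 nseqD catA.
  by rewrite -(cat1s a.+1 [:: a]) catA; apply: locplac_catr; rewrite cats1.
have move_in x : locplac (x :: c) (rcons c x) ->
    locplac [:: x; a.+1; a] [:: a.+1; a; x] ->
    locplac (x :: nseq q.+1 a.+1 ++ nseq q.+1 a)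
            (rcons (nseq q.+1 a.+1 ++ nseq q.+1 a) x).
  move=> xc x_ba; apply: locplac_trans (locplac_cons x c_eq) _.
  rewrite -cat_cons; apply: locplac_trans (locplac_catr _ xc) _.
  rewrite -[rcons (nseq _ _ ++ _) x]cats1.
  apply: (locplac_trans _ (locplac_sym (locplac_catr [:: x] c_eq))).
  by rewrite cat_rcons -catA; apply: locplac_catl.
split; first exact: (move_in a IHa (locplac_aba a)).
exact: (move_in a.+1 IHb (locplac_sym (locplac_bab a))).
Qed.

Lemma locplac_insert q m a : q <= m ->
  locplac (a :: nseq q a.+1 ++ nseq m a) (nseq q a.+1 ++ nseq m.+1 a).
Proof.
move=> /subnKC <-; rewrite -addnS !nseqD !catA -cat_cons.
rewrite -cat_rcons; apply: locplac_catr.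
exact: (locplac_central q a).1.
Qed.

Lemma locplac_eject q m a : m <= q ->
  locplac (nseq q.+1 a.+1 ++ nseq m a) (rcons (nseq q a.+1 ++ nseq m a) a.+1).
Proof.
move=> /subnK <-; rewrite -addnS !nseqD /= -!catA rcons_cat.
apply: locplac_catl; exact: (locplac_central m a).2.
Qed.

Lemma locplac_far_cons a z : all (ltn a.+1) z -> locplac (a :: z) (rcons z a).
Proof.
elim: z => //= b z IHz /andP[ab az].
apply: (locplac_trans _ (locplac_cons b (IHz az))).
exact: (locplac_catr z (locplac_far ab)).
Qed.

Lemma locplac_far_rcons a m : locplac (a.+2 :: nseq m 0) (rcons (nseq m 0) a.+2).
Proof.
elim: m => //= m IHm; apply: (locplac_trans _ (locplac_cons 0 IHm)).
exact: (locplac_catr (nseq m 0) (locplac_sym (@locplac_far 0 a.+2 isT))).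
Qed.

Lemma zword_split nu : exists z, [/\ all (ltn 1) z,
    map succn (zword nu) = z ++ nseq (nth 0 nu 0) 1
  & map succn (zword (incr_nth nu 0)) = z ++ nseq (nth 0 nu 0).+1 1].
Proof.
case: nu => [|m nu]; first by exists [::].
exists (map succn (map succn (zword nu))); split; rewrite /= ?map_cat ?map_nseq //.
  by rewrite !all_map; apply/allP.
by rewrite /= map_nseq.
Qed.

(** By shifting, the case [a = 0] is decisive: 0 passes the letters above 1 and is absorbed by the
    1's and 0's. If [a] is not addable, [incr_nth nu a] is not a partition and its word is the
    intermediate from which [zword_eject] expels [a]. *)
Lemma zword_insert nu a : is_partition nu ->
  locplac (a :: zword nu) (zword (incr_nth nu a)).
Proof.
elim: nu a => [|m nu IHnu] a; first (move=> _; elim: a => // a IHa).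
  have := locplac_shift IHa; rewrite /= cats0.
  by have -> : incr_nth [::] a = ncons a 0 [:: 1] by case: (a).
rewrite is_partition_cons => /and3P[_ le_m /IHnu{}IHnu].
case: a => [|a]; last exact: (locplac_catr (nseq m 0) (locplac_shift (IHnu a))).
have [z [z_gt1 z_eq _]] := zword_split nu; rewrite /= z_eq -!catA.
rewrite -cat_cons; apply: locplac_trans (locplac_catr _ (locplac_far_cons z_gt1)) _.
by rewrite cat_rcons; apply: locplac_catl; apply: locplac_insert.
Qed.

(** After shifting, the decisive case is [a = 1], where the second row has at least [m] boxes: its
    extra 1 passes the balanced block of 1's and 0's. Larger letters then commute with the 0's on
    their right. *)
Lemma zword_eject nu a : is_partition nu -> ~~ addable nu a ->
  locplac (zword (incr_nth nu a)) (rcons (zword nu) a).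
Proof.
elim: nu a => [|m nu IHnu] [|a] //.
  by move=> _ _; apply: locplac_sym; apply: (@zword_insert [::] a.+1).
rewrite is_partition_cons => /and3P[_ le_m /IHnu{}IHnu] nadd /=.
case: a nadd => [|a] nadd.
  have m_le : m <= nth 0 nu 0 by move: nadd; rewrite /addable /= -leqNgt.
  have [z [_ -> ->]] := zword_split nu.
  by rewrite -!catA rcons_cat; apply: locplac_catl; apply: locplac_eject.
have {IHnu nadd} IH := locplac_shift (IHnu a.+1 nadd).
apply: locplac_trans (locplac_catr _ IH) _; rewrite map_rcons cat_rcons rcons_cat.
by apply: locplac_catl; apply: locplac_far_rcons.
Qed.

(** * Reachability of the superstandard tableaux *)

Lemma map_eq_cat (l : nat -> nat) w u v : map l w = u ++ v ->
  exists p q, [/\ w = p ++ q, map l p = u & map l q = v].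
Proof.
move=> w_eq; exists (take (size u) w), (drop (size u) w).
by rewrite cat_take_drop map_take map_drop w_eq take_size_cat ?drop_size_cat.
Qed.

Lemma nth_cat2 (p : seq nat) a b q :
  nth 0 (p ++ [:: a; b] ++ q) (size p) = a /\
  nth 0 (p ++ [:: a; b] ++ q) (size p).+1 = b.
Proof. by elim: p. Qed.

Lemma labels_far_consecutive w x y
    (lx := cocharge_label w x) (ly := cocharge_label w y) :
  (lx.+1 < ly) || (ly.+1 < lx) -> ~~ consecutive x y.
Proof.
move=> xy; apply/negP => /orP[]/eqP eq_xy; move: xy; rewrite /lx /ly eq_xy.
  by have := cocharge_label_succ w y; lia.
by have := cocharge_label_succ w x; lia.
Qed.

Section Reachable.

Variables (f : seq nat -> seq nat) (la : seq nat).
Hypothesis f_props : catabolizability_properties f.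

(** Turns the invariances of [f] into closure properties of sets of label words, so that the process
    can be followed on labels alone. *)
Definition reachable (z : seq nat) : Prop :=
  exists w, [/\ is_standard w, cocharge_word w = z & f w = la].

Lemma reachable_far p a b q : (a.+1 < b) || (b.+1 < a) ->
  reachable (p ++ [:: a; b] ++ q) -> reachable (p ++ [:: b; a] ++ q).
Proof.
move=> ab [w [std_w w_lab fw]]; have := w_lab.
case/map_eq_cat=> p' [v [w_eq p_eq /map_eq_cat[u [q' [v_eq u_eq q_eq]]]]].
case: u u_eq v_eq => [|x [|y [|? u]]] //= [lx ly] v_eq; rewrite v_eq in w_eq.
have cons : ~~ consecutive x y by apply: (@labels_far_consecutive w); rewrite lx ly.
have [std_v v_lab] := cocharge_swap std_w w_eq cons.
exists (p' ++ [:: y; x] ++ q'); split=> //; first by rewrite v_lab p_eq lx ly q_eq.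
rewrite -fw; apply/esym/(catabolism_invariant f_props) => //.
exists p', x, y, q'; split=> //=; rewrite w_lab.
have -> : size p' = size p by rewrite -p_eq size_map.
by have [-> ->] := nth_cat2 p a b q.
Qed.

Lemma reachable_triple p a b c q : reachable (p ++ [:: a; b; c] ++ q) ->
  exists w p' x y z q', let l := cocharge_label w in
  [/\ is_standard w, f w = la, w = p' ++ [:: x; y; z] ++ q',
      [/\ (x < y) = (l x <= l y), (x < z) = (l x <= l z)
         & (y < z) = (l y <= l z)]
    & [/\ map l p' = p, map l q' = q, l x = a, l y = b & l z = c]].
Proof.
move=> [w [std_w w_lab fw]]; have := w_lab.
case/map_eq_cat=> p' [v [w_eq p_eq /map_eq_cat[u [q' [v_eq u_eq q_eq]]]]].
case: u u_eq v_eq => [|x [|y [|z [|? u]]]] //= [lx ly lz] v_eq.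
exists w, p', x, y, z, q'; split=> //; first by rewrite w_eq v_eq.
have := stdlab_standard std_w; rewrite {2}w_eq v_eq => /stdlab_catr.
rewrite -[_ :: _]/([:: x; y; z] ++ q') => /stdlab_catl.
by case/and3P=> /and3P[/eqP-> /eqP-> _] /andP[/eqP-> _] _.
Qed.

(** Equal labels increase from left to right and larger labels belong to larger entries, so the
    three entries form a Knuth pattern. The third entry lies between the two exchanged ones, which
    are thus not consecutive and keep their labels. *)
Lemma reachable_aba p a q :
  reachable (p ++ [:: a; a.+1; a] ++ q) <-> reachable (p ++ [:: a.+1; a; a] ++ q).
Proof.
split=> /reachable_triple[w [p' [x [y [z [q' [std_w fw w_eq [xy_l xz_l yz_l]]]]]]]].
- move=> [p_eq q_eq lx ly lz].
  have [xz zy] : x < z /\ z < y.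
    by rewrite xz_l lx lz leqnn (@cocharge_label_lt w) // ly lz.
  have cons : ~~ consecutive x y by rewrite /consecutive; lia.
  have [std_v v_lab] := cocharge_swap std_w (w_eq : w = p' ++ [:: x; y] ++ z :: q') cons.
  exists (p' ++ [:: y; x; z] ++ q'); split=> //; first by rewrite v_lab /= p_eq q_eq lx ly lz.
  rewrite -fw; apply/esym/(knuth_invariant f_props) => //; rewrite w_eq.
  by apply: Knuth_xzy; rewrite ltnW.
- move=> [p_eq q_eq lx ly lz].
  have [yz zx] : y < z /\ z < x.
    by rewrite yz_l ly lz leqnn (@cocharge_label_lt w) // lx lz.
  have cons : ~~ consecutive x y by rewrite /consecutive; lia.
  have [std_v v_lab] := cocharge_swap std_w (w_eq : w = p' ++ [:: x; y] ++ z :: q') cons.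
  exists (p' ++ [:: y; x; z] ++ q'); split=> //; first by rewrite v_lab /= p_eq q_eq lx ly lz.
  rewrite -fw; apply/esym/(knuth_invariant f_props) => //; rewrite w_eq.
  by apply: Knuth_zxy; rewrite ltnW.
Qed.

Lemma reachable_bab p a q :
  reachable (p ++ [:: a.+1; a; a.+1] ++ q) <->
  reachable (p ++ [:: a.+1; a.+1; a] ++ q).
Proof.
split=> /reachable_triple[w [p' [x [y [z [q' [std_w fw w_eq [xy_l xz_l yz_l]]]]]]]].
- move=> [p_eq q_eq lx ly lz].
  have [yx xz] : y < x /\ x < z.
    by rewrite xz_l lx lz leqnn (@cocharge_label_lt w) // lx ly.
  have cons : ~~ consecutive y z by rewrite /consecutive; lia.
  have w_eq' : w = rcons p' x ++ [:: y; z] ++ q' by rewrite w_eq cat_rcons.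
  have [std_v v_lab] := cocharge_swap std_w w_eq' cons.
  rewrite cat_rcons in std_v v_lab.
  exists (p' ++ [:: x; z; y] ++ q'); split=> //.
    by rewrite v_lab map_rcons cat_rcons p_eq q_eq lx ly lz.
  rewrite -fw; apply/esym/(knuth_invariant f_props) => //; rewrite w_eq.
  by apply: Knuth_yxz; rewrite yx ltnW.
- move=> [p_eq q_eq lx ly lz].
  have [zx xy] : z < x /\ x < y.
    by rewrite xy_l lx ly leqnn (@cocharge_label_lt w) // lx lz.
  have cons : ~~ consecutive y z by rewrite /consecutive; lia.
  have w_eq' : w = rcons p' x ++ [:: y; z] ++ q' by rewrite w_eq cat_rcons.
  have [std_v v_lab] := cocharge_swap std_w w_eq' cons.
  rewrite cat_rcons in std_v v_lab.
  exists (p' ++ [:: x; z; y] ++ q'); split=> //.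
    by rewrite v_lab map_rcons cat_rcons p_eq q_eq lx ly lz.
  rewrite -fw; apply/esym/(knuth_invariant f_props) => //; rewrite w_eq.
  by apply: Knuth_yzx; rewrite zx ltnW.
Qed.

Lemma reachable_locplac u v : locplac u v ->
  forall p q, reachable (p ++ u ++ q) <-> reachable (p ++ v ++ q).
Proof.
elim=> {u v} [u|u v _ IH|v u w _ IH1 _ IH2|u u' v v' _ IHu _ IHv|a b ab|a|a] p q.
- by [].
- by split=> /IH.
- by split=> [/IH1/IH2|/IH2/IH1].
- by rewrite -!catA; split=> /IHu; rewrite catA => /IHv; rewrite -catA //.
- by split; apply: reachable_far; rewrite ab ?orbT.
- exact: reachable_aba.
- exact: reachable_bab.
Qed.

Lemma reachable_corotation z a : 0 < a ->
  reachable (rcons z a) -> reachable (a.+1 :: z).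
Proof.
move=> a_gt0 [w [std_w w_lab fw]].
case/lastP: w std_w w_lab fw => [|w x] std_w w_lab fw.
  by move/(congr1 size): w_lab; rewrite size_rcons.
have := w_lab; rewrite /cocharge_word map_rcons.
case/rcons_inj=> z_eq lx.
have := cocharge_corotation std_w; rewrite lx z_eq => /(_ a_gt0)[x_n1 std_v v_lab].
exists (x :: w); split=> //; rewrite -fw; apply/esym/(corotation_invariant f_props) => //.
by exists w, x; split=> //; rewrite w_lab last_rcons.
Qed.

(** The state [(x, nu)] is represented by [x ++ zword nu]. An accepted letter is absorbed by
    [zword_insert]; a rejected one is inserted, expelled at the right end by [zword_eject], and
    brought to the front, raised by one, by a corotation. *)
Lemma reachable_zword N x nu mu : is_partition nu ->
  iter N step (x, nu) = ([::], mu) -> reachable (x ++ zword nu) ->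
  reachable (zword mu).
Proof.
elim: N x nu => [|N IHN] x nu part_nu; first by case=> -> ->.
rewrite iterSr; case/lastP: x => [|x a]; first exact: IHN.
rewrite step_rcons /offer /= cat_rcons.
have := reachable_locplac (zword_insert a part_nu) x [::]; rewrite !cats0.
case: ifP => [add_a|/negbT nadd_a] ins evN /ins reach_z.
  by apply: IHN evN reach_z; apply: is_partition_incr.
apply: IHN evN _ => //; rewrite cat_cons; apply: reachable_corotation.
  by case: (a) nadd_a.
have := reachable_locplac (zword_eject part_nu nadd_a) x [::]; rewrite !cats0.
by case=> /(_ reach_z); rewrite rcons_cat.
Qed.

End Reachable.

(** * The cocharge word of Z* *)

Fixpoint zrow (la : seq nat) (i : nat) : nat :=
  if la is m :: la' then if i < m then 0 else (zrow la' (i - m)).+1 else 0.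

(** The reading word of Z* with entries starting at [o], so that the lower rows are again of this
    form. *)
Definition zstd (o : nat) (la : seq nat) : seq nat :=
  rowword (reshape la (iota o (sumn la))).

Lemma zstd_cons o m la : zstd o (m :: la) = zstd (o + m) la ++ iota o m.
Proof.
rewrite /zstd [reshape _ _]/= rowword_cons drop_iota take_iota.
by rewrite [sumn _]/= addKn (minn_idPl (leq_addr _ _)).
Qed.

Lemma perm_zstd o la : perm_eq (zstd o la) (iota o (sumn la)).
Proof.
elim: la o => [|m la IHla] o //; rewrite zstd_cons /= iotaD perm_catC perm_cat2l.
exact: IHla.
Qed.

Lemma map_zstd o la : map (fun x => zrow la (x - o)) (zstd o la) = zword la.
Proof.
elim: la o => [|m la IHla] o //; rewrite zstd_cons map_cat [RHS]/=; congr (_ ++ _).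
  rewrite -(IHla (o + m)) -map_comp; apply/eq_in_map => x.
  rewrite (perm_mem (perm_zstd _ _)) mem_iota /= => /andP[le_x _].
  by rewrite ltnNge leq_subRL ?le_x ?subnDA //; lia.
apply: (@eq_from_nth _ 0) => [|i]; first by rewrite size_map size_iota size_nseq.
rewrite size_map size_iota => i_lt; rewrite (nth_map 0) ?size_iota //.
by rewrite nth_iota // nth_nseq i_lt addKn /= i_lt.
Qed.

Lemma index_iota_lt o m x y : x < y -> y < o + m -> o <= x ->
  index x (iota o m) < index y (iota o m).
Proof.
elim: m o => [|m IHm] o; first by lia.
move=> xy y_lt o_le /=; have -> : (o == y) = false by lia.
by case: eqP => // o_x; rewrite ltnS IHm //; lia.
Qed.

(** In the reading word [x + 1] stands left of [x] exactly when [x] ends its row. This is the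
    recursion defining cocharge labels. *)
Lemma zrow_index o la x : 0 \notin la -> o <= x -> x.+1 < o + sumn la ->
  zrow la (x.+1 - o) =
  zrow la (x - o) + (index x.+1 (zstd o la) < index x (zstd o la)).
Proof.
elim: la o => [|m la IHla] o /=; first by lia.
rewrite inE negb_or => /andP[m_n0 la0] o_le x_lt; rewrite zstd_cons !index_cat.
rewrite !(perm_mem (perm_zstd _ _)) !mem_iota.
case: (ltnP x (o + m)) => [x_lt_m|m_le]; last first.
  have -> : (o + m <= x.+1 < o + m + sumn la) by lia.
  have -> : x < o + m + sumn la by lia.
  have -> : (x.+1 - o < m) = false by lia.
  have -> : (x - o < m) = false by lia.
  by rewrite -!subnDA IHla //; lia.
case: (ltnP x.+1 (o + m)) => [x1_lt|x1_ge] /=.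
  have -> : x.+1 - o < m by lia.
  have -> : x - o < m by lia.
  by rewrite ltn_add2l ltnNge ltnW // index_iota_lt.
have -> : x - o < m by lia.
have -> : (x.+1 - o < m) = false by lia.
have -> : x.+1 < o + m + sumn la by lia.
have -> : x.+1 - o - m = 0 by lia.
(* As no part is 0, the entry following a row starts the very next row. *)
have -> : zrow la 0 = 0.
  by case: la la0 {IHla x_lt} => //= k la; rewrite inE negb_or; case: k.
rewrite ltn_addr // index_mem (perm_mem (perm_zstd _ _)) mem_iota; lia.
Qed.

Lemma superstandard_standard la : is_standard (rowword (superstandard la)).
Proof.
have := perm_zstd 1 la; rewrite /is_standard -/(zstd 1 la) => perm_z.
by rewrite (perm_size perm_z) size_iota.
Qed.

Lemma superstandard_cocharge la : is_partition la ->
  cocharge_word (rowword (superstandard la)) = zword la.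
Proof.
case/andP=> _ la0; rewrite -(map_zstd 1 la) -/(zstd 1 la).
apply/eq_in_map => x; rewrite (perm_mem (perm_zstd _ _)) mem_iota.
elim: x => // x IHx x_lt; have [->|x_n0] := eqVneq x 0.
  by case: la la0 {IHx x_lt} => //= k la; rewrite inE negb_or; case: k.
rewrite cocharge_labelS ?lt0n // zrow_index ?IHx //; lia.
Qed.

(** * Invariance of [ctype] and the characterization *)

Lemma ctype_corotation : invariant_under nonzero_corotation ctype.
Proof.
move=> u v std_u std_v [w [a [u_eq v_eq a_n1]]].
have [ev_u _] := ctype_cocharge std_u; have [ev_v _] := ctype_cocharge std_v.
rewrite u_eq v_eq in std_u ev_u ev_v *.
rewrite /cocharge_word map_rcons last_rcons in ev_u * => la_gt0.
have [_ _ v_lab] := cocharge_corotation std_u la_gt0; rewrite v_lab in ev_v.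
apply: ev_fun ev_v; move/ev_step: ev_u; rewrite step_rcons /offer /addable /= !nth_nil.
by rewrite gtn_eqF.
Qed.

Lemma locplac_ctype u v : is_standard u -> is_standard v ->
  locplac (cocharge_word u) (cocharge_word v) -> ctype u = ctype v.
Proof.
move=> std_u std_v uv; have [ev_u _] := ctype_cocharge std_u.
have [ev_v _] := ctype_cocharge std_v.
by apply: ev_fun ev_v; apply: locplac_ev uv ev_u.
Qed.

Lemma ctype_catabolism : invariant_under catabolism_transformation ctype.
Proof.
move=> u v std_u std_v [p [a [b [q [u_eq v_eq]]]]] /=.
have u_lab : cocharge_word u = map (cocharge_label u) p ++
    [:: cocharge_label u a; cocharge_label u b] ++ map (cocharge_label u) q.
  by rewrite /cocharge_word {2}u_eq !map_cat.
rewrite u_lab -(size_map (cocharge_label u) p).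
have [-> ->] := nth_cat2 (map (cocharge_label u) p) (cocharge_label u a)
                 (cocharge_label u b) (map (cocharge_label u) q).
set la := cocharge_label u a in u_lab *; set lb := cocharge_label u b in u_lab *.
move=> far; have cons := labels_far_consecutive far.
have [_ v_lab] := cocharge_swap std_u u_eq cons.
apply: locplac_ctype => //; rewrite u_lab v_eq v_lab.
apply: locplac_catl; apply: locplac_catr.
by case/orP: far => far; last apply: locplac_sym; apply: locplac_far.
Qed.

Lemma ctype_knuth : invariant_under knuth_transformation ctype.
Proof.
have xzy p q x y z (u := p ++ [:: x; z; y] ++ q) (v := p ++ [:: z; x; y] ++ q) :
    is_standard u -> is_standard v -> x <= y < z -> ctype u = ctype v.
  (* Entries are distinct, so [y] lies strictly between [x] and [z]. *)
  move=> std_u std_v xyz; have cons : ~~ consecutive x z.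
    have := standard_uniq std_u; rewrite /u !cat_uniq /= !inE /consecutive; lia.
  have [_ v_lab] := cocharge_swap std_u (erefl : u = p ++ [:: x; z] ++ y :: q) cons.
  apply: locplac_ctype => //; rewrite {}v_lab /cocharge_word {2}/u !map_cat.
  apply: locplac_catl; apply: (locplac_catr (map _ q) (locplac_xzy _)).
  have := stdlab_standard std_u; rewrite {2}/u.
  rewrite -[[:: x; z; y] ++ q]/([:: x] ++ [:: z; y] ++ q) => /stdlab_catr/stdlab_catr.
  rewrite cocharge_label_mono //=; last by case/andP: xyz.
  by case/andP=> /andP[/stdlabP]; lia.
have yxz p q x y z (u := p ++ [:: y; x; z] ++ q) (v := p ++ [:: y; z; x] ++ q) :
    is_standard u -> is_standard v -> x < y <= z -> ctype u = ctype v.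
  move=> std_u std_v xyz; have cons : ~~ consecutive x z.
    have := standard_uniq std_u; rewrite /u !cat_uniq /= !inE /consecutive; lia.
  have u_eq : u = rcons p y ++ [:: x; z] ++ q by rewrite cat_rcons.
  have [_] := cocharge_swap std_u u_eq cons; rewrite cat_rcons => v_lab.
  apply: locplac_ctype => //; rewrite {}v_lab /cocharge_word {2}/u !map_cat map_rcons cat_rcons.
  apply: locplac_catl; apply: (locplac_catr (map _ q) (locplac_yxz _)).
  have := stdlab_standard std_u; rewrite {2}/u => /stdlab_catr.
  rewrite cocharge_label_mono ?andbT //=; last by case/andP: xyz.
  by case/andP=> /andP[/stdlabP]; lia.
by move=> u v + + uv; case: uv => p q x y z xyz std_u std_v;
  [|apply/esym| |apply/esym]; eauto.
Qed.

Theorem corollary3p5 :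
  catabolizability_properties ctype /\
  (forall f : seq nat -> seq nat,
     catabolizability_properties f ->
     forall w : seq nat, is_standard w -> f w = ctype w).
Proof.
split; first split.
- by move=> w /ctype_cocharge[].
- exact: ctype_corotation.
- by move=> u v std_u std_v vu; apply/esym/ctype_corotation.
- exact: ctype_catabolism.
- exact: ctype_knuth.
- move=> la part_la; have [ev_z _] := ctype_cocharge (superstandard_standard la).
  by move: ev_z; rewrite superstandard_cocharge // => /(ev_fun (ev_zword part_la)).
move=> f f_props w std_w; have [ev_w part_w] := ctype_cocharge std_w.
have [N evN] := ev_w.
(* The value tracked by [reachable] is [f w], with [w] itself as the first witness. *)
have reach_w : reachable f (f w) (cocharge_word w ++ zword [::]).
  by rewrite cats0; exists w.
have [v [std_v v_lab <-]] :=
  reachable_zword f_props (isT : is_partition [::]) evN reach_w.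
(* The word [v] has the cocharge word of Z* of shape [ctype w], hence equals its reading word, where
   the value of [f] is prescribed. *)
rewrite -[RHS](superstandard_value f_props part_w); congr f.
apply: cocharge_word_inj => //; first exact: superstandard_standard.
by rewrite v_lab superstandard_cocharge.
Qed.
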